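(* Let $Z\in\mathbb{N}^\mathbb{N}$ and let $\alpha$ be a $Z$-computable well-ordering. If $\mathcal{X}$ is a $Z$-computable linear ordering and $\boldsymbol\varphi(\alpha,\mathcal{X})$ has a $Z$-computable descending sequence, then $Z^{(\omega^\alpha)}$ computes a descending sequence in $\mathcal{X}$.
   Context: A descending sequence is an infinite strictly decreasing sequence. $Z^{(\beta)}$ denotes the $\beta$-th iterated Turing jump of $Z$ along the well-ordering $\beta$. For linear orderings $\mathcal{Y},\mathcal{X}$, $\boldsymbol\varphi(\mathcal{Y},\mathcal{X})$ is the set of formal terms: $0$ and $\varphi_{\mathcal{Y},x}$ ($x\in\mathcal{X}$) are terms (''constants''); if $t_1,t_2$ are terms so is $t_1+t_2$; if $t$ is a term and $\delta\in\mathcal{Y}$ then $\varphi_\delta(t)$ is a term. A term $t=t_0+\dots+t_k$ is in normal form if $t=0$ or (a) $t_0\geq\dots\geq t_k>0$ and (b) each $t_i$ is a constant or $\varphi_\delta(s_i)$ with $s_i$ in normal form and not of the form $\varphi_{\delta'}(s')$ with $\delta'>\delta$. Normal forms are obtained via: $+$ associative; $s+0=0+s=s$; if $\varphi_{\delta'}(s)<\varphi_\delta(r)$ then $\varphi_{\delta'}(s)+\varphi_\delta(r)=\varphi_\delta(r)$; if $\delta'>\delta$ then $\varphi_\delta(\varphi_{\delta'}(r))=\varphi_{\delta'}(r)$; $\varphi_\delta(\varphi_{\mathcal{Y},x})=\varphi_{\mathcal{Y},x}$. For $t=t_0+\dots+t_k$, $s=s_0+\dots+s_l$ in normal form, $t\leq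 s$ iff one of: $t=0$; $t=\varphi_{\mathcal{Y},x}$ and $\varphi_{\mathcal{Y},y}$ occurs in $s$ for some $y\geq_{\mathcal{X}}x$; $t=\varphi_\delta(t')$, $s_0=\varphi_{\delta'}(s')$ and either ($\delta<\delta'$ and $t'\leq\varphi_{\delta'}(s')$) or ($\delta=\delta'$ and $t'\leq s'$) or ($\delta>\delta'$ and $\varphi_\delta(t')\leq s'$); $k>0$ and $t_0<s_0$; $k>0$, $t_0=s_0$, $l>0$ and $t_1+\dots+t_k\leq s_1+\dots+s_l$. $\boldsymbol\varphi(\alpha,\mathcal{X})$ denotes this with $\mathcal{Y}=\alpha$. *)

(* Defs.v *)
From Stdlib Require Import Arith List Lia Classical ClassicalEpsilon.
Import ListNotations.
Set Implicit Arguments.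

Definition cpair (m n : nat) : nat := (m + n) * (m + n + 1) / 2 + n.

Definition pchar (P : nat -> Prop) : nat -> nat :=
  fun n => if excluded_middle_informative (P n) then 1 else 0.
Definition pchar2 (R : nat -> nat -> Prop) : nat -> nat -> nat :=
  fun m n => if excluded_middle_informative (R m n) then 1 else 0.

Inductive prog : Type :=
| PZero
| PSucc
| PProj (i : nat)
| POrc
| PComp (f : prog) (gs : list prog)
| PRec (f g : prog)
| PMu (f : prog).

Inductive eval (Z : nat -> nat) : prog -> list nat -> nat -> Prop :=
| ev_zero v : eval Z PZero v 0
| ev_succ v : eval Z PSucc v (S (hd 0 v))
| ev_proj i v : eval Z (PProj i) v (nth i v 0)
| ev_orc v : eval Z POrc v (Z (hd 0 v))
| ev_comp f gs v ws y :
    evals Z gs v ws -> eval Z f ws y -> eval Z (PComp f gs) v y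
| ev_rec0 f g v y : eval Z f v y -> eval Z (PRec f g) (0 :: v) y
| ev_recS f g m v r y :
    eval Z (PRec f g) (m :: v) r -> eval Z g (m :: r :: v) y ->
    eval Z (PRec f g) (S m :: v) y
| ev_mu f v n :
    eval Z f (n :: v) 0 ->
    (forall m, m < n -> exists k, eval Z f (m :: v) (S k)) ->
    eval Z (PMu f) v n
with evals (Z : nat -> nat) : list prog -> list nat -> list nat -> Prop :=
| evs_nil v : evals Z nil v nil
| evs_cons g gs v w ws :
    eval Z g v w -> evals Z gs v ws -> evals Z (g :: gs) v (w :: ws).

Fixpoint code_prog (p : prog) : nat :=
  match p with
  | PZero => cpair 0 0
  | PSucc => cpair 1 0
  | PProj i => cpair 2 i
  | POrc => cpair 3 0
  | PComp f gs =>
      cpair 4 (cpair (code_prog f)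
        ((fix cl (l : list prog) : nat :=
            match l with
            | nil => 0
            | g :: l' => S (cpair (code_prog g) (cl l'))
            end) gs))
  | PRec f g => cpair 5 (cpair (code_prog f) (code_prog g))
  | PMu f => cpair 6 (code_prog f)
  end.

Definition computable1 (Z : nat -> nat) (f : nat -> nat) : Prop :=
  exists p, forall n, eval Z p [n] (f n).
Definition computable2 (Z : nat -> nat) (f : nat -> nat -> nat) : Prop :=
  exists p, forall m n, eval Z p [m; n] (f m n).

Definition jumpP (A : nat -> nat) (k : nat) : Prop :=
  exists p m y, k = cpair (code_prog p) m /\ eval A p [m] y.

Definition join (Z A : nat -> nat) (k : nat) : nat :=
  if Nat.even k then Z (Nat.div2 k) else A (Nat.div2 k).

Record LO := { fld : nat -> Prop ; leo : nat -> nat -> Prop }.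

Definition lto (L : LO) (x y : nat) : Prop := leo L x y /\ x <> y.

Definition is_LO (L : LO) : Prop :=
  (forall x y, leo L x y -> fld L x /\ fld L y) /\
  (forall x, fld L x -> leo L x x) /\
  (forall x y, leo L x y -> leo L y x -> x = y) /\
  (forall x y z, leo L x y -> leo L y z -> leo L x z) /\
  (forall x y, fld L x -> fld L y -> leo L x y \/ leo L y x).

Definition descending (L : LO) (f : nat -> nat) : Prop :=
  forall n, fld L (f n) /\ lto L (f (S n)) (f n).

Definition is_WO (L : LO) : Prop :=
  is_LO L /\ ~ (exists f, descending L f).

Definition computable_LO (Z : nat -> nat) (L : LO) : Prop :=
  computable1 Z (pchar (fld L)) /\ computable2 Z (pchar2 (leo L)).

Definition below (B : LO) (Y : nat -> Prop) (b : nat) (k : nat) : Prop :=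
  exists c n, k = cpair c n /\ lto B c b /\ Y (cpair c n).

Definition jump_hierarchy (Z : nat -> nat) (B : LO) (Y : nat -> Prop) : Prop :=
  (forall b n, ~ fld B b -> ~ Y (cpair b n)) /\
  (forall b n, fld B b ->
     (Y (cpair b n) <-> jumpP (join Z (pchar (below B Y b))) n)).

(* omega^alpha: codes of finite non-increasing sequences of elements of
   alpha (Cantor normal forms omega^a1 + ... + omega^an), ordered
   lexicographically (a proper prefix is smaller).                     *)
Fixpoint code_list (s : list nat) : nat :=
  match s with
  | nil => 0
  | a :: s' => S (cpair a (code_list s'))
  end.

Fixpoint nonincr (A : LO) (s : list nat) : Prop :=
  match s with
  | nil => True
  | a :: s' => fld A a /\
      match s' with nil => True | b :: _ => leo A b a end /\ nonincr A s'
  end.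

Fixpoint lex_lt (A : LO) (s t : list nat) : Prop :=
  match s, t with
  | nil, _ :: _ => True
  | a :: s', b :: t' => lto A a b \/ (a = b /\ lex_lt A s' t')
  | _, _ => False
  end.

Definition omega_exp (A : LO) : LO :=
  {| fld := fun n => exists s, n = code_list s /\ nonincr A s ;
     leo := fun m n => exists s t, m = code_list s /\ n = code_list t /\
              nonincr A s /\ nonincr A t /\ (lex_lt A s t \/ s = t) |}.

(* The term system phi(alpha, X).  Terms are represented modulo
   associativity of + and s+0 = s: a term is a (possibly empty) sum
   t_0 + ... + t_k of "atoms", each atom being a constant phi_{Y,x} or
   phi_delta(s).                                                        *)
Inductive term : Type :=
| TZero
| TSum (a : atom) (t : term)
with atom : Type :=
| AConst (x : nat)
| APhi (d : nat) (t : term).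

Definition single (a : atom) : term := TSum a TZero.

Fixpoint occ_t (y : nat) (t : term) : Prop :=
  match t with
  | TZero => False
  | TSum a r => occ_a y a \/ occ_t y r
  end
with occ_a (y : nat) (a : atom) : Prop :=
  match a with
  | AConst z => z = y
  | APhi _ s => occ_t y s
  end.

Section PhiOrder.
Variables (A X : LO).

(* t <= s on normal forms. *)
Inductive le_t : term -> term -> Prop :=
| le_zero s : le_t TZero s
| le_const x y s : occ_t y s -> leo X x y -> le_t (single (AConst x)) s
| le_phi_lt d t' d' s' r :
    lto A d d' -> le_t t' (single (APhi d' s')) ->
    le_t (single (APhi d t')) (TSum (APhi d' s') r)
| le_phi_eq d t' s' r :
    le_t t' s' -> le_t (single (APhi d t')) (TSum (APhi d s') r)
| le_phi_gt d t' d' s' r :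
    lto A d' d -> le_t (single (APhi d t')) s' ->
    le_t (single (APhi d t')) (TSum (APhi d' s') r)
| le_phi_const d t' y r :
    (* s_0 = phi_{alpha,y} is treated as phi with index above all of alpha *)
    le_t t' (single (AConst y)) ->
    le_t (single (APhi d t')) (TSum (AConst y) r)
| le_head_lt a t1 b s1 :
    t1 <> TZero -> le_t (single a) (single b) -> a <> b ->
    le_t (TSum a t1) (TSum b s1)
| le_head_eq a t1 s1 :
    t1 <> TZero -> s1 <> TZero -> le_t t1 s1 ->
    le_t (TSum a t1) (TSum a s1).

Definition lt_t (t s : term) : Prop := le_t t s /\ t <> s.

(* phi_d(s) is irreducible: s is neither a constant nor phi_{d'}(s')
   with d' > d. *)
Definition phi_arg_ok (d : nat) (s : term) : Prop :=
  match s with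
  | TSum (APhi d' _) TZero => ~ lto A d d'
  | TSum (AConst _) TZero => False
  | _ => True
  end.

Fixpoint nf_t (t : term) : Prop :=
  match t with
  | TZero => True
  | TSum a r => nf_a a /\ nf_t r /\
      match r with TZero => True | TSum b _ => le_t (single b) (single a) end
  end
with nf_a (a : atom) : Prop :=
  match a with
  | AConst x => fld X x
  | APhi d s => fld A d /\ nf_t s /\ phi_arg_ok d s
  end.

Definition phi_descending (g : nat -> term) : Prop :=
  forall n, nf_t (g n) /\ lt_t (g (S n)) (g n).

End PhiOrder.

Fixpoint code_term (t : term) : nat :=
  match t with
  | TZero => 0
  | TSum a r => S (cpair (code_atom a) (code_term r))
  end
with code_atom (a : atom) : nat :=
  match a with
  | AConst x => cpair 0 x
  | APhi d s => cpair 1 (cpair d (code_term s))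
  end.

(* Main.v *)
(** A descending sequence of sums yields, with one jump, a descending sequence of
    summands: the jump decides whether the current leading summand ever changes
    again, and if it does not one moves on to the next summand.  Replacing phi_0(t)
    by t in the result gives a descending sequence of terms again.  Iterating this
    along omega^alpha attaches to a sum of powers c + omega^gamma a sequence of
    terms that is obtained from the one at c by passing to atoms closed under all
    phi_delta with delta < gamma, and then from phi_gamma(t) to t.  For gamma > 0
    this is done as follows.  Let t be the first term at c and x its leading atom
    that is closed below gamma; then t is below a tower
    phi_delta(... phi_delta(x + 1) ...) for some delta < gamma, so the sequence at
    c + omega^delta + ... + omega^delta, with as many powers as there are levels,
    starts below x; it yields the next atom x' < x, and so on.  With no bound on
    gamma the atoms obtained are constants, that is, elements of X.

    One program computes all these sequences.  It only ever asks the columns of the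
    jump hierarchy about its own behaviour with a smaller oracle, so it needs
    a code of itself merely as a number to be written into queries, and no universal
    program is required. *)

Require Import Defs.
From Stdlib Require Import Arith List Lia Classical ClassicalEpsilon FunctionalExtensionality.
Import ListNotations.
Set Implicit Arguments.

(** * Linear orders and the order of normal forms *)

(* The obstacle is uniformity: there is one sequence for every sum of powers, and deciding facts
   about one of them means asking the jump about a code. The code [e] of the test program is
   therefore an input of the program, and the test program passes it on, so a question about the
   sequence at [r] is an arithmetical expression in [e] and [r] and no fixed-point theorem enters.
   Terms of earlier sequences are not recomputed: a column tells whether the [k]-th term is [v], and
   a search for [v] recovers it. The columns consulted must lie below the ordinal reached; this is
   [cnf_lt], the additive closure of omega^c. Sums stay plain lists of exponents, because lists with
   the same value carry different sequences; the normal form only selects the column. Each collapsed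
   sequence starts one atom late. The gap this leaves turns a bound x + 1 on the first term into the
   strict bound x, which makes the atoms found along the way descend. *)
Scheme term_mut := Induction for term Sort Prop
with atom_mut := Induction for atom Sort Prop.
Combined Scheme term_atom_ind from term_mut, atom_mut.

Fixpoint tsize (t : term) : nat :=
  match t with TZero => 0 | TSum a r => S (asize a + tsize r) end
with asize (a : atom) : nat :=
  match a with AConst _ => 1 | APhi _ s => S (tsize s) end.

Lemma asize_pos a : 1 <= asize a.
Proof. destruct a; simpl; lia. Qed.

Lemma LO_refl L x : is_LO L -> fld L x -> leo L x x.
Proof. intros (_ & H & _). auto. Qed.
Lemma LO_antisym L x y : is_LO L -> leo L x y -> leo L y x -> x = y.
Proof. intros (_ & _ & H & _). auto. Qed.
Lemma LO_trans L x y z : is_LO L -> leo L x y -> leo L y z -> leo L x z.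
Proof. intros (_ & _ & _ & H & _). eauto. Qed.
Lemma LO_total L x y : is_LO L -> fld L x -> fld L y -> leo L x y \/ leo L y x.
Proof. intros (_ & _ & _ & _ & H). auto. Qed.
Lemma LO_fld L x y : is_LO L -> leo L x y -> fld L x /\ fld L y.
Proof. intros (H & _). auto. Qed.
Lemma LO_lt_trans L x y z : is_LO L -> lto L x y -> lto L y z -> lto L x z.
Proof.
  intros H [H1 H2] [H3 H4]. split; [eapply LO_trans; eauto|].
  intros <-. apply H2. eapply LO_antisym; eauto.
Qed.
Lemma LO_lt_le_trans L x y z : is_LO L -> lto L x y -> leo L y z -> lto L x z.
Proof.
  intros H [H1 H2] H3. split; [eapply LO_trans; eauto|].
  intros <-. apply H2. eapply LO_antisym; eauto.
Qed.
Lemma LO_tri L x y : is_LO L -> fld L x -> fld L y -> lto L x y \/ x = y \/ lto L y x.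
Proof.
  intros H Hx Hy. destruct (Nat.eq_dec x y); [tauto|].
  destruct (LO_total x y H Hx Hy); [left|right; right]; split; auto.
Qed.
Lemma LO_lt_asym L x y : is_LO L -> lto L x y -> lto L y x -> False.
Proof. intros H [H1 H2] [H3 H4]. apply H2. eapply LO_antisym; eauto. Qed.
Lemma LO_nlt L x y : is_LO L -> fld L x -> fld L y -> (lto L x y <-> ~ leo L y x).
Proof.
  intros H Hx Hy. split.
  - intros [H1 H2] H3. apply H2. eapply LO_antisym; eauto.
  - intros Hn. destruct (LO_total x y H Hx Hy); [|tauto]. split; auto. intros ->. tauto.
Qed.

Arguments LO_refl {L x} _ _.
Arguments LO_antisym {L x y} _ _ _.
Arguments LO_trans {L x y z} _ _ _.
Arguments LO_total {L x y} _ _ _.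
Arguments LO_fld {L x y} _ _.
Arguments LO_lt_trans {L x y z} _ _ _.
Arguments LO_lt_le_trans {L x y z} _ _ _.
Arguments LO_tri {L x y} _ _ _.
Arguments LO_lt_asym {L x y} _ _ _.
Arguments LO_nlt {L x y} _ _ _.

Section Order.
Variables A X : LO.
Hypothesis HA : is_LO A.
Hypothesis HX : is_LO X.
Notation le := (le_t A X).
Notation lt := (lt_t A X).
Notation nf := (nf_t A X).
Notation nfa := (nf_a A X).

Lemma nf_single a : nf (single a) <-> nfa a.
Proof. simpl. tauto. Qed.

Lemma occ_fld :
  (forall t y, nf t -> occ_t y t -> fld X y) /\
  (forall a y, nfa a -> occ_a y a -> fld X y).
Proof.
  apply term_atom_ind; simpl; intros; subst; try tauto.
  - destruct H1 as (? & ? & ?). destruct H2; eauto.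
  - destruct H0 as (? & ? & ?). eauto.
Qed.

Lemma le_refl_ta :
  (forall t, nf t -> le t t) /\ (forall a, nfa a -> le (single a) (single a)).
Proof.
  apply term_atom_ind; intros.
  - constructor.
  - simpl in H1. destruct H1 as (Ha & Hr & _).
    destruct t; [exact (H Ha)|]. apply le_head_eq; try discriminate. auto.
  - apply le_const with x; simpl; auto. apply LO_refl; auto.
  - apply le_phi_eq. apply H. apply H0.
Qed.

Lemma le_refl t : nf t -> le t t.
Proof. apply le_refl_ta. Qed.

(* The two halves are proved together: comparing sums looks only at their heads,
   and heads of summands are compared by the order itself. *)
Lemma occ_mono_head n :
  (forall t s, tsize t < n -> nf t -> le t s ->
     forall y, occ_t y t -> exists y', occ_t y' s /\ leo X y y') /\
  (forall a r, tsize (TSum a r) < n -> nf (TSum a r) ->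
     forall y, occ_t y (TSum a r) -> exists y', occ_a y' a /\ leo X y y').
Proof.
  induction n as [|n [IHB IHA]]; [split; intros; lia|].
  assert (HAA : forall r a, tsize (TSum a r) < S n -> nf (TSum a r) ->
     forall y, occ_t y (TSum a r) -> exists y', occ_a y' a /\ leo X y y').
  { intros r. induction r as [|b r IHr]; intros a Hs Hn y Ho.
    - destruct Ho as [Ho|[]]. exists y. split; auto.
      apply LO_refl; auto. eapply (proj2 occ_fld); eauto. apply Hn.
    - destruct Hn as (Ha & Hr & Hba). destruct Ho as [Ho|Ho].
      + exists y. split; auto.
        apply LO_refl; auto. eapply (proj2 occ_fld); eauto.
      + simpl in Hs. destruct (IHr b) with y as (y1 & Ho1 & Hy1); auto.
        { simpl. pose proof (asize_pos a). lia. }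
        destruct (IHB (single b) (single a)) with y1 as (y2 & Ho2 & Hy2); auto.
        { simpl. pose proof (asize_pos a). lia. }
        { apply nf_single. apply Hr. }
        { left. auto. }
        destruct Ho2 as [Ho2|[]].
        exists y2. split; auto. eapply (LO_trans HX); eauto. }
  split; [|intros; eapply HAA; eauto].
  intros t s Hs Hn Hle. induction Hle; intros z Hz.
  - destruct Hz.
  - simpl in Hz. destruct Hz as [->|[]]. eauto.
  - destruct Hz as [Hz|[]].
    simpl in Hs. destruct Hn as ((? & ? & ?) & _).
    edestruct IHHle as (y' & Ho & Hy); eauto; [lia|].
    exists y'. split; auto. simpl in *. tauto.
  - destruct Hz as [Hz|[]].
    simpl in Hs. destruct Hn as ((? & ? & ?) & _).
    edestruct IHHle as (y' & Ho & Hy); eauto; [lia|].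
    exists y'. split; auto. simpl in *. tauto.
  - edestruct IHHle as (y' & Ho & Hy); eauto.
    exists y'. split; auto. simpl in *. tauto.
  - destruct Hz as [Hz|[]].
    simpl in Hs. destruct Hn as ((? & ? & ?) & _).
    edestruct IHHle as (y' & Ho & Hy); eauto; [lia|].
    exists y'. split; auto. simpl in *. tauto.
  - destruct (HAA t1 a) with z as (z1 & Ho1 & Hz1); auto.
    edestruct IHHle as (y' & Ho & Hy).
    + simpl in Hs |- *. lia.
    + apply nf_single. apply Hn.
    + left. exact Ho1.
    + exists y'. split; [|eapply (LO_trans HX); eauto]. simpl in *. tauto.
  - destruct Hz as [Hz|Hz].
    + exists z. split; [left; auto|]. apply LO_refl; auto.
      eapply (proj2 occ_fld); eauto. apply Hn.
    + edestruct IHHle as (y' & Ho & Hy); eauto.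
      * simpl in Hs. lia.
      * apply Hn.
      * exists y'. split; auto. right. auto.
Qed.

Lemma le_single_sum a b r : le (single a) (single b) -> le (single a) (TSum b r).
Proof.
  intros H. inversion H; subst; try (now constructor; auto).
  apply le_const with y; auto. simpl in *. tauto.
Qed.

(** This makes the order lexicographic on sums. The rule [le_const] may find its constant anywhere
    in the right side; in a normal form that constant is dominated by one in the head, by
    [occ_mono_head]. *)
Lemma le_sum_iff a r b r' : nf (TSum a r) -> nf (TSum b r') ->
  (le (TSum a r) (TSum b r') <->
   (lt (single a) (single b) \/ a = b /\ le r r')).
Proof.
  intros Hn Hn'. split.
  - intros H.
    assert (Hcase : r = TZero -> le (single a) (single b) ->
       lt (single a) (single b) \/ a = b /\ le r r').
    { intros -> Hab. destruct (classic (a = b)) as [->|Hne].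
      - right. split; auto. constructor.
      - left. split; auto. intros [=]. auto. }
    inversion H; subst.
    + apply Hcase; auto.
      destruct (proj2 (occ_mono_head (S (tsize (TSum b r')))) b r') with y as (y' & Ho & Hy); auto.
      apply le_const with y'; [left; auto|]. eapply (LO_trans HX); eauto.
    + apply Hcase; auto. now apply le_phi_lt.
    + apply Hcase; auto. now apply le_phi_eq.
    + apply Hcase; auto. now apply le_phi_gt.
    + apply Hcase; auto. now apply le_phi_const.
    + left. split; auto. intros [=]. auto.
    + right. auto.
  - intros [[H1 H2]|[-> H]].
    + destruct r as [|c r].
      * now apply le_single_sum.
      * apply le_head_lt; auto; [discriminate|]. intros ->. auto.
    + destruct r as [|c r].
      * apply le_single_sum. apply le_refl. simpl in *. tauto.
      * apply le_head_eq; auto; [discriminate|]. intros ->. inversion H; subst.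
        match goal with Ho : occ_t _ TZero |- _ => destruct Ho end.
Qed.

(** A constant counts as an atom whose level exceeds every index. With this convention the three
    lemmas [le_atom_lt], [le_atom_eq] and [le_atom_gt] are the Veblen comparison rules, constants
    included. *)
Definition lev_lt (a b : atom) : Prop :=
  match a, b with
  | APhi d _, APhi d' _ => lto A d d'
  | APhi _ _, AConst _ => True
  | _, _ => False
  end.
Definition lev_eq (a b : atom) : Prop :=
  match a, b with
  | APhi d _, APhi d' _ => d = d'
  | AConst _, AConst _ => True
  | _, _ => False
  end.
Definition arg (a : atom) : term :=
  match a with APhi _ s => s | AConst _ => TZero end.
Definition le_arg (a b : atom) : Prop :=
  match a, b with
  | APhi _ s, APhi _ s' => le s s'
  | AConst x, AConst y => leo X x y
  | _, _ => False
  end.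

Lemma lev_tri a b : nfa a -> nfa b -> lev_lt a b \/ lev_eq a b \/ lev_lt b a.
Proof.
  destruct a, b; simpl; auto. intros (H1 & _) (H2 & _).
  apply LO_tri; auto.
Qed.
Lemma lev_lt_trans a b c : lev_lt a b -> lev_lt b c -> lev_lt a c.
Proof. destruct a, b, c; simpl; try tauto. apply LO_lt_trans; auto. Qed.
Lemma lev_lt_eq a b c : lev_lt a b -> lev_eq b c -> lev_lt a c.
Proof. destruct a, b, c; simpl; try tauto. intros ? <-; auto. Qed.
Lemma lev_eq_lt a b c : lev_eq a b -> lev_lt b c -> lev_lt a c.
Proof. destruct a, b, c; simpl; try tauto. intros <-; auto. Qed.
Lemma lev_eq_trans a b c : lev_eq a b -> lev_eq b c -> lev_eq a c.
Proof. destruct a, b, c; simpl; try tauto. intros <-; auto. Qed.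
Lemma lev_eq_sym a b : lev_eq a b -> lev_eq b a.
Proof. destruct a, b; simpl; auto. Qed.

Lemma le_atom_lt a b : lev_lt a b ->
  (le (single a) (single b) <-> le (arg a) (single b)).
Proof.
  destruct a as [x|d s], b as [y|d' s']; simpl; try tauto; intros Hl; split; intros H.
  - inversion H; subst; auto; congruence.
  - now apply le_phi_const.
  - inversion H; subst; auto; try congruence.
    + destruct Hl. congruence.
    + exfalso. eapply (LO_lt_asym HA); eauto.
  - now apply le_phi_lt.
Qed.

Lemma le_atom_eq a b : lev_eq a b ->
  (le (single a) (single b) <-> le_arg a b).
Proof.
  destruct a as [x|d s], b as [y|d' s']; simpl; try tauto; intros Hl; split; intros H.
  - inversion H; subst; try congruence. simpl in *. match goal with Ho : _ \/ False |- _ => destruct Ho as [->|[]] end. auto.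
  - apply le_const with y; simpl; auto.
  - subst. inversion H; subst; auto; try congruence;
      match goal with Hx : lto A ?u ?u |- _ => destruct Hx; congruence end.
  - subst. now apply le_phi_eq.
Qed.

Lemma le_atom_gt a b : lev_lt b a ->
  (le (single a) (single b) <-> le (single a) (arg b)).
Proof.
  destruct a as [x|d s], b as [y|d' s']; simpl; try tauto; intros Hl; split; intros H.
  - inversion H; subst; try congruence. simpl in *.
    apply le_const with y; auto. tauto.
  - inversion H; subst; try congruence; apply le_const with y; auto; simpl in *; tauto.
  - inversion H; subst; auto; try congruence.
    + exfalso. eapply (LO_lt_asym HA); eauto.
    + destruct Hl; congruence.
  - now apply le_phi_gt.
Qed.

Lemma nfa_arg a : nfa a -> nf (arg a).
Proof. destruct a; simpl; tauto. Qed.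

Lemma arg_not_single a b : nfa a -> lev_lt a b -> arg a <> single b.
Proof.
  destruct a as [x|d s], b as [y|d' s']; simpl; try tauto; intros (_ & _ & H) Hl ->; simpl in H; tauto.
Qed.

Lemma tsize_arg a : tsize (arg a) < asize a.
Proof. destruct a; simpl; lia. Qed.

Lemma le_zero_inv t : le t TZero -> t = TZero.
Proof. intros H. inversion H; subst; auto. inversion H0. Qed.

(** For atoms at different levels the two inequalities squeeze the higher atom onto the argument of
    the lower one, which irreducibility ([arg_not_single]) forbids. *)
Lemma antisym_aux n : forall t s, tsize t + tsize s < n -> nf t -> nf s ->
  le t s -> le s t -> t = s.
Proof.
  induction n as [|n IH]; intros t s Hn Ht Hs H1 H2; [lia|].
  destruct t as [|a r]; [symmetry; now apply le_zero_inv|].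
  destruct s as [|b r']; [now apply le_zero_inv|].
  assert (Hab : le (single a) (single b) -> le (single b) (single a) -> a = b).
  { intros L1 L2.
    assert (Na : nfa a) by apply Ht. assert (Nb : nfa b) by apply Hs.
    simpl in Hn. pose proof (tsize_arg a). pose proof (tsize_arg b).
    destruct (lev_tri a b Na Nb) as [Hl|[Hl|Hl]].
    - exfalso. eapply arg_not_single with (b := b); [exact Na|exact Hl|]. apply IH; simpl; try tauto; try lia.
      + now apply nfa_arg.
      + now apply le_atom_lt.
      + now apply le_atom_gt in L2.
    - apply le_atom_eq in L1; auto. apply le_atom_eq in L2; auto using lev_eq_sym.
      destruct a, b; simpl in *; try tauto.
      + f_equal. eapply (LO_antisym HX); eauto.
      + subst. f_equal. apply IH; auto; try lia; tauto.
    - exfalso. eapply arg_not_single with (b := a); [exact Nb|exact Hl|]. apply IH; simpl; try tauto; try lia.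
      + now apply nfa_arg.
      + now apply le_atom_lt.
      + now apply le_atom_gt in L1. }
  apply le_sum_iff in H1; auto. apply le_sum_iff in H2; auto.
  destruct H1 as [[H1 H1']|[-> H1]], H2 as [[H2 H2']|[H2 H3]].
  - exfalso. apply H1'. rewrite Hab; auto.
  - subst. tauto.
  - exfalso. auto.
  - f_equal. simpl in Hn. apply IH; auto; try lia; [apply Ht|apply Hs].
Qed.

Lemma le_antisym t s : nf t -> nf s -> le t s -> le s t -> t = s.
Proof. intros. eapply antisym_aux; eauto. Qed.

Lemma total_aux n : forall t s, tsize t + tsize s < n -> nf t -> nf s ->
  le t s \/ le s t.
Proof.
  induction n as [|n IH]; intros t s Hn Ht Hs; [lia|].
  destruct t as [|a r]; [left; constructor|].
  destruct s as [|b r']; [right; constructor|].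
  assert (Na : nfa a) by apply Ht. assert (Nb : nfa b) by apply Hs.
  simpl in Hn. pose proof (tsize_arg a). pose proof (tsize_arg b).
  assert (Hab : le (single a) (single b) \/ le (single b) (single a)).
  { destruct (lev_tri a b Na Nb) as [Hl|[Hl|Hl]].
    - destruct (IH (arg a) (single b)); simpl; try tauto; try lia.
      + now apply nfa_arg.
      + left. now apply le_atom_lt.
      + right. now apply le_atom_gt.
    - destruct a, b; simpl in Hl; try tauto.
      + destruct (LO_total HX Na Nb); [left|right]; apply le_atom_eq; simpl; auto.
      + destruct (IH t t0); simpl in *; try lia; try tauto; [left|right]; apply le_atom_eq; simpl; auto.
    - destruct (IH (arg b) (single a)); simpl; try tauto; try lia.
      + now apply nfa_arg.
      + right. now apply le_atom_lt.
      + left. now apply le_atom_gt. }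
  rewrite (le_sum_iff Ht Hs). rewrite (le_sum_iff Hs Ht).
  destruct (classic (a = b)) as [->|Hne].
  - destruct (IH r r'); try lia; [apply Ht|apply Hs|auto|auto].
  - assert (single a <> single b) by (intros [=]; auto).
    destruct Hab; [left|right]; left; split; auto.
Qed.

Lemma le_total t s : nf t -> nf s -> le t s \/ le s t.
Proof. intros. eapply total_aux; eauto. Qed.

Lemma trans_aux n : forall t s u, tsize t + tsize s + tsize u < n ->
  nf t -> nf s -> nf u -> le t s -> le s u -> le t u.
Proof.
  induction n as [|n IH]; intros t s u Hn Ht Hs Hu H1 H2; [lia|].
  destruct t as [|a r]; [constructor|].
  destruct s as [|b r']; [apply le_zero_inv in H1; discriminate|].
  destruct u as [|c r'']; [apply le_zero_inv in H2; discriminate|].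
  assert (Na : nfa a) by apply Ht. assert (Nb : nfa b) by apply Hs.
  assert (Nc : nfa c) by apply Hu.
  simpl in Hn. pose proof (tsize_arg a). pose proof (tsize_arg b). pose proof (tsize_arg c).
  assert (Habc : le (single a) (single b) -> le (single b) (single c) -> le (single a) (single c)).
  { intros L1 L2.
    assert (Ka := nfa_arg _ Na). assert (Kb := nfa_arg _ Nb). assert (Kc := nfa_arg _ Nc).
    assert (Sa : nf (single a)) by now apply nf_single.
    assert (Sb : nf (single b)) by now apply nf_single.
    assert (Sc : nf (single c)) by now apply nf_single.
    assert (E1 : le (arg a) (single b) -> le (arg a) (single c)).
    { intros. apply IH with (single b); auto. simpl. lia. }
    assert (E2 : le (single b) (arg c) -> le (single a) (arg c)).
    { intros. apply IH with (single b); auto. simpl. lia. }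
    destruct (lev_tri a b Na Nb) as [Hl|[Hl|Hl]];
    destruct (lev_tri b c Nb Nc) as [Hm|[Hm|Hm]].
    - apply le_atom_lt; [eapply lev_lt_trans; eauto|]. apply le_atom_lt in L1; auto.
    - apply le_atom_lt; [eapply lev_lt_eq; eauto|]. apply le_atom_lt in L1; auto.
    (* Here [b] has the highest level, so the hypotheses only relate it to the arguments of [a] and
       [c]. How these combine depends on a further comparison of the levels of [a] and [c]. *)
    - apply le_atom_lt in L1; auto. assert (L2' := L2). apply le_atom_gt in L2'; auto.
      destruct (lev_tri a c Na Nc) as [Hk|[Hk|Hk]].
      + apply le_atom_lt; auto.
      + apply le_atom_eq; auto.
        destruct a as [x|d s], c as [y|d' s']; simpl in Hk; try tauto.
        cbn [arg le_arg asize] in *. apply IH with (single b); auto. simpl; lia.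
      + apply le_atom_gt; auto.
    - apply le_atom_lt; [eapply lev_eq_lt; eauto|]. apply le_atom_eq in L1; auto.
      apply le_atom_lt in L2; auto. destruct a, b; simpl in *; try tauto.
      apply IH with t0; auto; try tauto. simpl in *; lia.
    - apply le_atom_eq; [eapply lev_eq_trans; eauto|].
      apply le_atom_eq in L1; auto. apply le_atom_eq in L2; auto.
      destruct a, b, c; simpl in *; try tauto.
      + eapply (LO_trans HX); eauto.
      + apply IH with t0; auto; try tauto. simpl in *; lia.
    - apply le_atom_gt; [destruct a, b, c; simpl in *; try tauto; congruence|].
      apply le_atom_gt in L2; auto.
    - apply le_atom_gt in L1; auto. apply le_atom_lt in L2; auto.
      apply IH with (arg b); auto. simpl; lia.
    - apply le_atom_gt in L1; auto. apply le_atom_eq in L2; auto.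
      apply le_atom_gt; [destruct a, b, c; simpl in *; try tauto; congruence|].
      destruct b, c; simpl in *; try tauto.
      apply IH with t; auto. simpl; lia.
    - apply le_atom_gt; [eapply lev_lt_trans; eauto|]. apply le_atom_gt in L2; auto. }
  assert (Hasym : le (single a) (single b) -> le (single b) (single a) -> a = b).
  { intros L1 L2. assert (E : single a = single b) by (apply le_antisym; auto; now apply nf_single).
    injection E; auto. }
  apply le_sum_iff in H1; auto. apply le_sum_iff in H2; auto. apply le_sum_iff; auto.
  destruct H1 as [[H1 H1']|[-> H1]], H2 as [[H2 H2']|[H2 H4]].
  - left. split; auto. intros E. injection E as ->. apply H1'. f_equal. auto.
  - subst. left. split; auto.
  - left. split; auto.
  - subst. right. split; auto. apply IH with r'; auto; try lia; [apply Ht|apply Hs|apply Hu].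
Qed.

Lemma le_trans t s u : nf t -> nf s -> nf u -> le t s -> le s u -> le t u.
Proof. intros ? ? ? H1 H2. eapply trans_aux with (s := s); eauto. Qed.

Lemma lt_le_trans t s u : nf t -> nf s -> nf u -> lt t s -> le s u -> lt t u.
Proof.
  intros Ht Hs Hu [H1 H2] H3. split; [now apply le_trans with s|].
  intros <-. apply H2. apply le_antisym; auto.
Qed.
Lemma le_lt_trans t s u : nf t -> nf s -> nf u -> le t s -> lt s u -> lt t u.
Proof.
  intros Ht Hs Hu H1 [H2 H3]. split; [now apply le_trans with s|].
  intros <-. apply H3. apply le_antisym; auto.
Qed.
Lemma lt_trans t s u : nf t -> nf s -> nf u -> lt t s -> lt s u -> lt t u.
Proof. intros Ht Hs Hu H1 [H2 _]. now apply lt_le_trans with s. Qed.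
Lemma lt_not_le t s : nf t -> nf s -> lt t s -> ~ le s t.
Proof. intros Ht Hs [H1 H2] H3. apply H2. apply le_antisym; auto. Qed.
Lemma not_le_lt t s : nf t -> nf s -> ~ le s t -> lt t s.
Proof.
  intros Ht Hs H. destruct (le_total t s Ht Hs); [|tauto]. split; auto.
  intros ->. tauto.
Qed.
Lemma lt_iff t s : nf t -> nf s -> (lt t s <-> ~ le s t).
Proof. intros; split; [apply lt_not_le|apply not_le_lt]; auto. Qed.
Lemma lt_zero t : ~ lt t TZero.
Proof. intros [H1 H2]. apply H2. now apply le_zero_inv. Qed.

End Order.

(** * Programs *)

Definition tri (n : nat) : nat := n * (n + 1) / 2.

Lemma tri_S n : tri (S n) = tri n + S n.
Proof.
  unfold tri. replace (S n * (S n + 1)) with (n * (n + 1) + S n * 2) by lia.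
  now rewrite Nat.div_add.
Qed.

Lemma tri_mono m n : m <= n -> tri m <= tri n.
Proof. induction 1; auto. rewrite tri_S. lia. Qed.

Lemma cpair_tri m n : cpair m n = tri (m + n) + n.
Proof. reflexivity. Qed.

(** The largest [k] with [tri k <= z], by recursion on [z] instead of a square root, so that a
    primitive recursive program follows it step by step. *)
Fixpoint croot (z : nat) : nat :=
  match z with
  | 0 => 0
  | S z' => if tri (S (croot z')) <=? S z' then S (croot z') else croot z'
  end.

Lemma croot_S z :
  croot (S z) = if tri (S (croot z)) <=? S z then S (croot z) else croot z.
Proof. reflexivity. Qed.

Lemma croot_spec z : tri (croot z) <= z < tri (S (croot z)).
Proof.
  induction z as [|z IH]; [cbv; lia|].
  rewrite croot_S. destruct (Nat.leb_spec (tri (S (croot z))) (S z)); [|lia].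
  split; auto. rewrite tri_S. lia.
Qed.

Definition csnd (z : nat) : nat := z - tri (croot z).
Definition cfst (z : nat) : nat := croot z - csnd z.

Lemma croot_cpair m n : croot (cpair m n) = m + n.
Proof.
  pose proof (croot_spec (cpair m n)) as [H1 H2]. rewrite cpair_tri in *.
  destruct (lt_eq_lt_dec (croot (tri (m + n) + n)) (m + n)) as [[H|H]|H]; auto; exfalso.
  - apply (tri_mono) in H. lia.
  - apply tri_mono in H. rewrite tri_S in H. lia.
Qed.
Lemma csnd_cpair m n : csnd (cpair m n) = n.
Proof. unfold csnd. rewrite croot_cpair, cpair_tri. lia. Qed.
Lemma cfst_cpair m n : cfst (cpair m n) = m.
Proof. unfold cfst. rewrite csnd_cpair, croot_cpair. lia. Qed.
Lemma cpair_inj m n m' n' : cpair m n = cpair m' n' -> m = m' /\ n = n'.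
Proof.
  intros H. split.
  - rewrite <- (cfst_cpair m n), H. apply cfst_cpair.
  - rewrite <- (csnd_cpair m n), H. apply csnd_cpair.
Qed.
Lemma cpair_ge_r m n : n <= cpair m n.
Proof. rewrite cpair_tri. lia. Qed.
Lemma cpair_ge_l m n : m <= cpair m n.
Proof.
  rewrite cpair_tri. assert (H : forall k, k <= tri k); [|specialize (H (m + n)); lia].
  induction k; [lia|]. rewrite tri_S. lia.
Qed.

Arguments cpair : simpl never.
Arguments cfst : simpl never.
Arguments csnd : simpl never.
Arguments croot : simpl never.
Arguments tri : simpl never.

Section ProgInd.
Variable P : prog -> Prop.
Hypothesis HZero : P PZero.
Hypothesis HSucc : P PSucc.
Hypothesis HProj : forall i, P (PProj i).
Hypothesis HOrc : P POrc.
Hypothesis HComp : forall f gs, P f -> Forall P gs -> P (PComp f gs).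
Hypothesis HRec : forall f g, P f -> P g -> P (PRec f g).
Hypothesis HMu : forall f, P f -> P (PMu f).
Fixpoint prog_nested_ind (p : prog) : P p :=
  match p with
  | PZero => HZero
  | PSucc => HSucc
  | PProj i => HProj i
  | POrc => HOrc
  | PComp f gs => HComp (prog_nested_ind f)
      ((fix go l : Forall P l :=
          match l with
          | nil => Forall_nil P
          | g :: l' => Forall_cons g (prog_nested_ind g) (go l')
          end) gs)
  | PRec f g => HRec (prog_nested_ind f) (prog_nested_ind g)
  | PMu f => HMu (prog_nested_ind f)
  end.
End ProgInd.

Lemma eval_fun Z p : forall v y y', eval Z p v y -> eval Z p v y' -> y = y'.
Proof.
  induction p as [| |i| |f gs IHf IHgs|f g IHf IHg|f IHf] using prog_nested_ind;
    intros v y y' H1 H2.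
  - inversion H1; inversion H2; subst; auto.
  - inversion H1; inversion H2; subst; auto.
  - inversion H1; inversion H2; subst; auto.
  - inversion H1; inversion H2; subst; auto.
  - inversion H1 as [| | | |? ? ? ws ? E1 F1| | |]; subst.
    inversion H2 as [| | | |? ? ? ws' ? E2 F2| | |]; subst.
    assert (ws = ws').
    { clear - IHgs E1 E2. revert ws ws' E1 E2.
      induction IHgs as [|g gs Hg _ IH]; intros ws ws' E1 E2;
        inversion E1; inversion E2; subst; auto.
      f_equal; eauto. }
    subst. eauto.
  - destruct v as [|m v]; [inversion H1|].
    revert y y' H1 H2. induction m as [|m IHm]; intros y y' H1 H2;
      inversion H1; inversion H2; subst; eauto.
    assert (r = r0) by eauto. subst. eauto.
  - inversion H1 as [| | | | | | |? ? ? A1 B1]; subst.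
    inversion H2 as [| | | | | | |? ? ? A2 B2]; subst.
    destruct (lt_eq_lt_dec y y') as [[H|H]|H]; auto; exfalso.
    + destruct (B2 _ H) as [k Hk]. specialize (IHf _ _ _ A1 Hk). discriminate.
    + destruct (B1 _ H) as [k Hk]. specialize (IHf _ _ _ A2 Hk). discriminate.
Qed.

Fixpoint code_progs (l : list prog) : nat :=
  match l with
  | nil => 0
  | g :: l' => S (cpair (code_prog g) (code_progs l'))
  end.

Lemma code_prog_comp f gs :
  code_prog (PComp f gs) = cpair 4 (cpair (code_prog f) (code_progs gs)).
Proof. reflexivity. Qed.

Lemma code_prog_inj p : forall q, code_prog p = code_prog q -> p = q.
Proof.
  induction p as [| |i| |f gs IHf IHgs|f g IHf IHg|f IHf] using prog_nested_ind;
    intros q H; destruct q; try rewrite !code_prog_comp in H; cbn [code_prog] in H;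
    repeat match goal with
    | K : cpair _ _ = cpair _ _ |- _ => apply cpair_inj in K; destruct K
    end; try discriminate; subst; auto.
  - f_equal; auto.
    match goal with K : code_progs gs = code_progs ?l |- _ =>
      rename K into E; rename l into gs' end.
    clear - IHgs E. revert gs' E.
    induction IHgs as [|g gs Hg _ IH]; intros [|g' l] H; cbn in H; try discriminate; auto.
    injection H as H. apply cpair_inj in H. destruct H. f_equal; auto.
  - f_equal; auto.
  - f_equal; auto.
Qed.

Lemma ev_eq Z p v y y' : eval Z p v y -> y = y' -> eval Z p v y'.
Proof. intros H <-. exact H. Qed.

(** [st] is the run of the recursion. Only the steps before [n] have to converge, so the step
    program may be partial elsewhere. *)
Lemma ev_prec Z f g (st : nat -> nat) v n :
  eval Z f v (st 0) ->
  (forall i, i < n -> eval Z g (i :: st i :: v) (st (S i))) ->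
  eval Z (PRec f g) (n :: v) (st n).
Proof.
  intros H0 HS. induction n as [|n IH].
  - now constructor.
  - apply ev_recS with (st n); [apply IH; intros; apply HS; lia|apply HS; lia].
Qed.

Create HintDb evdb discriminated.
#[export] Hint Constants Opaque : evdb.

Ltac ev :=
  lazymatch goal with
  | |- evals _ nil _ _ => apply evs_nil
  | |- evals _ (_ :: _) _ _ => eapply evs_cons; [ev|ev]
  | |- eval _ (PComp _ _) _ _ => eapply ev_comp; [ev|ev]
  | |- eval ?Z (PProj ?i) ?v _ =>
      let e := eval cbn [nth] in (nth i v 0) in
      exact (ev_proj Z i v : eval Z (PProj i) v e)
  | |- eval ?Z PSucc ?v _ =>
      let e := eval cbn [hd] in (S (hd 0 v)) in
      exact (ev_succ Z v : eval Z PSucc v e)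
  | |- eval _ PZero _ _ => apply ev_zero
  | |- eval _ _ _ _ => solve [eauto with evdb]
  end.
Ltac evs :=
  eapply ev_eq;
  [first [ev | lazymatch goal with |- eval _ ?p _ _ => unfold p; ev end]|].

Fixpoint p_cst (n : nat) : prog :=
  match n with 0 => PZero | S n' => PComp PSucc [p_cst n'] end.
Lemma ev_cst Z n v : eval Z (p_cst n) v n.
Proof.
  induction n as [|n IH]; cbn; [constructor|].
  apply ev_comp with [n]; [repeat constructor; auto|]. exact (ev_succ Z [n]).
Qed.
#[export] Hint Resolve ev_cst : evdb.

Definition p_pred : prog := PRec PZero (PProj 0).
Lemma ev_pred Z x : eval Z p_pred [x] (pred x).
Proof. apply (@ev_prec Z _ _ pred); [constructor|]. intros i _. exact (ev_proj Z 0 _). Qed.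
#[export] Hint Resolve ev_pred : evdb.

Definition p_add : prog := PRec (PProj 0) (PComp PSucc [PProj 1]).
Lemma ev_add Z x y : eval Z p_add [x; y] (x + y).
Proof.
  apply (@ev_prec Z _ _ (fun x => x + y)); [exact (ev_proj Z 0 _)|].
  intros i _. evs. reflexivity.
Qed.
#[export] Hint Resolve ev_add : evdb.

Definition p_sub : prog :=
  PComp (PRec (PProj 0) (PComp p_pred [PProj 1])) [PProj 1; PProj 0].
Lemma ev_sub Z x y : eval Z p_sub [x; y] (x - y).
Proof.
  eapply ev_comp; [ev|]. cbn.
  apply (@ev_prec Z _ _ (fun y => x - y)).
  - evs. lia.
  - intros i _. evs. lia.
Qed.
#[export] Hint Resolve ev_sub : evdb.

Definition cif (c a b : nat) : nat := match c with 0 => b | S _ => a end.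
Definition p_if : prog := PRec (PProj 1) (PProj 2).
Lemma ev_if Z c a b : eval Z p_if [c; a; b] (cif c a b).
Proof.
  apply (@ev_prec Z _ _ (fun c => cif c a b)).
  - evs. reflexivity.
  - intros i _. evs. reflexivity.
Qed.
#[export] Hint Resolve ev_if : evdb.

Definition cnot (x : nat) : nat := match x with 0 => 1 | S _ => 0 end.
Definition p_not : prog := PRec (p_cst 1) PZero.
Lemma ev_not Z x : eval Z p_not [x] (cnot x).
Proof.
  apply (@ev_prec Z _ _ cnot); [apply ev_cst|]. intros; constructor.
Qed.
#[export] Hint Resolve ev_not : evdb.

Definition ceq (x y : nat) : nat := if x =? y then 1 else 0.
Definition p_eq : prog :=
  PComp p_not [PComp p_add [PComp p_sub [PProj 0; PProj 1]; PComp p_sub [PProj 1; PProj 0]]].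
Lemma ev_ceq Z x y : eval Z p_eq [x; y] (ceq x y).
Proof.
  evs. unfold ceq. destruct (Nat.eqb_spec x y) as [->|H].
  - now rewrite Nat.sub_diag.
  - destruct (x - y + (y - x)) eqn:E; [lia|reflexivity].
Qed.
#[export] Hint Resolve ev_ceq : evdb.

Lemma ceq_1 x y : ceq x y = 1 <-> x = y.
Proof. unfold ceq. destruct (Nat.eqb_spec x y); split; intros; congruence. Qed.
Lemma ceq_0 x y : ceq x y = 0 <-> x <> y.
Proof. unfold ceq. destruct (Nat.eqb_spec x y); split; intros; congruence. Qed.

Definition p_tri : prog := PRec PZero (PComp p_add [PProj 1; PComp PSucc [PProj 0]]).
Lemma ev_tri Z n : eval Z p_tri [n] (tri n).
Proof.
  apply (@ev_prec Z _ _ tri); [constructor|]. intros i _. evs. now rewrite tri_S.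
Qed.
#[export] Hint Resolve ev_tri : evdb.

Definition p_cpair : prog := PComp p_add [PComp p_tri [PComp p_add [PProj 0; PProj 1]]; PProj 1].
Lemma ev_cpair Z m n : eval Z p_cpair [m; n] (cpair m n).
Proof. evs. reflexivity. Qed.
#[export] Hint Resolve ev_cpair : evdb.

Definition p_croot : prog :=
  PRec PZero
    (PComp p_if
      [PComp p_sub [PComp p_tri [PComp PSucc [PProj 1]]; PComp PSucc [PProj 0]];
       PProj 1; PComp PSucc [PProj 1]]).
Lemma ev_croot Z z : eval Z p_croot [z] (croot z).
Proof.
  apply (@ev_prec Z _ _ croot); [constructor|]. intros i _. evs.
  rewrite croot_S. destruct (Nat.leb_spec (tri (S (croot i))) (S i)).
  - replace (tri (S (croot i)) - S i) with 0 by lia. reflexivity.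
  - destruct (tri (S (croot i)) - S i) eqn:E; [lia|reflexivity].
Qed.
#[export] Hint Resolve ev_croot : evdb.

Definition p_csnd : prog := PComp p_sub [PProj 0; PComp p_tri [PComp p_croot [PProj 0]]].
Lemma ev_csnd Z z : eval Z p_csnd [z] (csnd z).
Proof. evs. reflexivity. Qed.
#[export] Hint Resolve ev_csnd : evdb.
Definition p_cfst : prog := PComp p_sub [PComp p_croot [PProj 0]; PComp p_csnd [PProj 0]].
Lemma ev_cfst Z z : eval Z p_cfst [z] (cfst z).
Proof. evs. reflexivity. Qed.
#[export] Hint Resolve ev_cfst : evdb.

Lemma evals_proj Z v : forall u,
  evals Z (map PProj (seq (length u) (length v))) (u ++ v) v.
Proof.
  induction v as [|a v IH]; intros u; cbn; [constructor|].
  constructor.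
  - replace a with (nth (length u) (u ++ a :: v) 0) at 2; [constructor|].
    rewrite app_nth2, Nat.sub_diag; auto.
  - specialize (IH (u ++ [a])). rewrite <- app_assoc in IH. cbn in IH.
    rewrite length_app in IH. cbn in IH. now rewrite Nat.add_1_r in IH.
Qed.

(* PComp evaluates all its arguments; primitive recursion on a flag is what
   prevents the evaluation of a branch that may diverge. *)
Definition p_guard (k : nat) (c a : prog) : prog :=
  PComp (PRec PZero (PComp a (map PProj (seq 2 k)))) (c :: map PProj (seq 0 k)).
Definition p_lif (k : nat) (c a b : prog) : prog :=
  PComp p_add [p_guard k c a; p_guard k (PComp p_not [c]) b].

Lemma ev_guard_false Z k c a v : length v = k -> eval Z c v 0 -> eval Z (p_guard k c a) v 0.
Proof.
  intros <- H. apply ev_comp with (0 :: v).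
  - constructor; auto. apply (evals_proj Z v []).
  - repeat constructor.
Qed.
Lemma ev_guard_true Z k c a v y : length v = k -> eval Z c v 1 -> eval Z a v y ->
  eval Z (p_guard k c a) v y.
Proof.
  intros <- H Ha. apply ev_comp with (1 :: v).
  - constructor; auto. apply (evals_proj Z v []).
  - apply ev_recS with 0; [repeat constructor|].
    apply ev_comp with v; auto. apply (evals_proj Z v [0; 0]).
Qed.
Lemma ev_lif_true Z k c a b v y : length v = k -> eval Z c v 1 -> eval Z a v y ->
  eval Z (p_lif k c a b) v y.
Proof.
  intros Hk Hc Ha. apply ev_comp with [y; 0]; [|evs; lia].
  repeat constructor.
  - now apply ev_guard_true.
  - apply ev_guard_false; auto. evs. reflexivity.
Qed.
Lemma ev_lif_false Z k c a b v y : length v = k -> eval Z c v 0 -> eval Z b v y ->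
  eval Z (p_lif k c a b) v y.
Proof.
  intros Hk Hc Ha. apply ev_comp with [0; y]; [|evs; lia].
  repeat constructor.
  - now apply ev_guard_false.
  - apply ev_guard_true; auto. evs. reflexivity.
Qed.

(** Composition of oracle reductions. [PComp r [PProj 0]] trims the argument list: the oracle reads
    the first entry only, and [r] is known only on lists of length one. *)
Fixpoint p_subst (r p : prog) : prog :=
  match p with
  | POrc => PComp r [PProj 0]
  | PComp f gs => PComp (p_subst r f) (map (p_subst r) gs)
  | PRec f g => PRec (p_subst r f) (p_subst r g)
  | PMu f => PMu (p_subst r f)
  | _ => p
  end.

Lemma ev_subst O A r p : (forall x, eval O r [x] (A x)) ->
  forall v y, eval A p v y -> eval O (p_subst r p) v y.
Proof.
  intros Hr. induction p as [| |i| |f gs IHf IHgs|f g IHf IHg|f IHf] using prog_nested_ind;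
    intros v y H; cbn.
  - inversion H; constructor.
  - inversion H; constructor.
  - inversion H; constructor.
  - inversion H; subst. apply ev_comp with [nth 0 v 0]; [repeat constructor|].
    destruct v; apply Hr.
  - inversion H as [| | | |? ? ? ws ? E1 F1| | |]; subst.
    apply ev_comp with ws; auto.
    clear - IHgs E1. revert ws E1.
    induction IHgs as [|g gs Hg _ IH]; intros ws E1; inversion E1; subst; constructor; auto.
  - destruct v as [|m v]; [inversion H|].
    revert y H. induction m as [|m IHm]; intros y H; inversion H; subst.
    + constructor; auto.
    + econstructor; eauto.
  - inversion H as [| | | | | | |? ? ? A1 B1]; subst. constructor; auto.
    intros m Hm. destruct (B1 m Hm) as [k Hk]. eauto.
Qed.

Lemma join_even Z W x : join Z W (x + x) = Z x.
Proof.
  unfold join. replace (x + x) with (2 * x) by lia.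
  rewrite Nat.even_even, Nat.div2_double. reflexivity.
Qed.
Lemma join_odd Z W x : join Z W (S (x + x)) = W x.
Proof.
  unfold join. replace (S (x + x)) with (S (2 * x)) by lia.
  rewrite Nat.even_succ, Nat.odd_even, Nat.div2_succ_double. reflexivity.
Qed.

Definition p_left : prog := PComp POrc [PComp p_add [PProj 0; PProj 0]].
Definition p_right : prog := PComp POrc [PComp PSucc [PComp p_add [PProj 0; PProj 0]]].
Lemma ev_left Z W x : eval (join Z W) p_left [x] (Z x).
Proof.
  eapply ev_comp; [ev|]. cbn. rewrite <- (join_even Z W x).
  exact (ev_orc (join Z W) [x + x]).
Qed.
Lemma ev_right Z W x : eval (join Z W) p_right [x] (W x).
Proof.
  eapply ev_comp; [ev|]. cbn. rewrite <- (join_odd Z W x).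
  exact (ev_orc (join Z W) [S (x + x)]).
Qed.
#[export] Hint Resolve ev_left ev_right : evdb.

(** * The exponential and the jump hierarchy *)

Lemma code_list_inj s : forall t, code_list s = code_list t -> s = t.
Proof.
  induction s as [|a s IH]; intros [|b t] H; cbn in H; try discriminate; auto.
  injection H as H. apply cpair_inj in H. destruct H. f_equal; auto.
Qed.

Lemma wf_of_no_descending L : is_LO L -> ~ (exists f, descending L f) ->
  well_founded (lto L).
Proof.
  intros HL Hd x. apply NNPP. intros Hx. apply Hd.
  set (T := {y | ~ Acc (lto L) y}).
  assert (Hstep : forall y : T, {z : T | lto L (proj1_sig z) (proj1_sig y)}).
  { intros [y Hy]. apply constructive_indefinite_description. cbn.
    apply NNPP. intros Hn. apply Hy. constructor. intros z Hz.
    apply NNPP. intros Hz'. apply Hn. exists (exist _ z Hz'). exact Hz. }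
  set (step := fun y => proj1_sig (Hstep y)).
  set (h := fun n => Nat.iter n step (exist _ x Hx)).
  assert (Hh : forall n, lto L (proj1_sig (h (S n))) (proj1_sig (h n))).
  { intros n. exact (proj2_sig (Hstep (h n))). }
  exists (fun n => proj1_sig (h n)). intros n. split; auto.
  destruct (Hh n) as [H _]. now apply (LO_fld HL) in H.
Qed.

Lemma lex_lt_irrefl A s : ~ lex_lt A s s.
Proof.
  induction s as [|a s IH]; cbn; auto. intros [[_ H]|[_ H]]; auto.
Qed.

Section OmegaExp.
Variable A : LO.
Hypothesis HA : is_LO A.
Hypothesis Hwf : well_founded (lto A).

Let R (s t : list nat) : Prop := lex_lt A s t /\ nonincr A s.

Lemma Acc_cons_aux a : (forall b, lto A b a -> forall s, nonincr A (b :: s) -> Acc R (b :: s)) ->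
  forall s, Acc R s -> nonincr A (a :: s) -> Acc R (a :: s).
Proof.
  intros Hb s Hs. induction Hs as [s _ IH]. intros Hn. constructor.
  intros [|b t] [Hlt Ht].
  - constructor. intros [|? ?] [[] _].
  - cbn in Hlt. destruct Hlt as [Hlt|[<- Hlt]]; [now apply Hb|].
    apply IH; auto. split; auto. apply Ht.
Qed.

(** The outer induction is on the leading exponent, the inner one on the list: the tail of [a :: s]
    begins with a smaller exponent, or with [a] again and is shorter. *)
Lemma Acc_nonincr : forall s, nonincr A s -> Acc R s.
Proof.
  assert (Hnil : Acc R []) by (constructor; intros [|? ?] [[] _]).
  assert (H : forall a s, nonincr A (a :: s) -> Acc R (a :: s)).
  { intros a. induction (Hwf a) as [a _ IH].
    induction s as [|b s IHs]; intros Hn.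
    - apply Acc_cons_aux; auto.
    - apply Acc_cons_aux; auto. destruct Hn as (Ha & Hba & Hn).
      destruct (Nat.eq_dec b a) as [->|Hne]; [auto|].
      apply IH; auto. split; auto. }
  intros [|a s]; auto.
Qed.

Lemma omega_exp_wf : well_founded (lto (omega_exp A)).
Proof.
  assert (H : forall s, nonincr A s -> Acc (lto (omega_exp A)) (code_list s)).
  { intros s Hs. induction (Acc_nonincr _ Hs) as [s _ IH].
    constructor. intros n [(u & t & -> & Ht & Nu & Nt & Hlt) Hne].
    apply code_list_inj in Ht. subst t.
    destruct Hlt as [Hlt| ->]; [|congruence].
    apply IH; auto. split; auto. }
  intros n. constructor. intros m [(u & t & -> & _ & Nu & _) _]. auto.
Qed.

(* An ordinal below omega^A is presented as a sum omega^(p_k) + ... + omega^(p_0),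
   not necessarily in Cantor normal form; the list [p] has the last summand at
   its head.  A summand is absorbed exactly when a larger one stands to its
   right, so the normal form consists of the weak left-to-right maxima of [p]. *)
Definition absorb (s : list nat) (a : nat) : list nat :=
  match s with
  | nil => [a]
  | b :: _ => match pchar2 (leo A) b a with 0 => s | S _ => a :: s end
  end.
Definition cnf (p : list nat) : list nat := fold_left absorb p [].

Lemma pchar2_cases (Q : nat -> nat -> Prop) x y :
  (pchar2 Q x y = 1 /\ Q x y) \/ (pchar2 Q x y = 0 /\ ~ Q x y).
Proof. unfold pchar2. destruct (excluded_middle_informative (Q x y)); tauto. Qed.

Lemma absorb_nonincr s a : fld A a -> nonincr A s -> nonincr A (absorb s a).
Proof.
  intros Ha Hs. destruct s as [|b s]; cbn; auto.
  destruct (pchar2_cases (leo A) b a) as [[-> H]|[-> H]]; auto.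
  cbn. auto.
Qed.

Lemma cnf_nonincr p : Forall (fld A) p -> nonincr A (cnf p).
Proof.
  unfold cnf. assert (H : nonincr A []) by exact I. revert H. generalize (@nil nat).
  induction p as [|a p IH]; intros s Hs Hp; auto.
  inversion Hp; subst. cbn. apply IH; auto. now apply absorb_nonincr.
Qed.

Lemma absorb_Forall (Q : nat -> Prop) s a : Q a -> Forall Q s -> Forall Q (absorb s a).
Proof.
  intros Ha Hs. destruct s as [|b s]; cbn; auto.
  destruct (pchar2 (leo A) b a); auto.
Qed.
Lemma cnf_Forall (Q : nat -> Prop) p : Forall Q p -> Forall Q (cnf p).
Proof.
  unfold cnf. assert (H : Forall Q []) by constructor. revert H. generalize (@nil nat).
  induction p as [|a p IH]; intros s Hs Hp; auto.
  inversion Hp; subst. cbn. apply IH; auto. now apply absorb_Forall.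
Qed.

(** Two runs of the absorption stay in step: decisions look only at the top of the stack, and once
    the common part [P] is empty, an exponent is either at least [c] and goes onto both stacks, or
    below [c] and only affects [L]. *)
Lemma absorb_common c p : fld A c -> Forall (fld A) p ->
  forall P L, Forall (fun x => lto A x c) L ->
  exists P' L', fold_left absorb p (P ++ L) = P' ++ L' /\
    fold_left absorb p (P ++ [c]) = P' ++ [c] /\ Forall (fun x => lto A x c) L'.
Proof.
  intros Hc. induction p as [|a p IH]; intros Hp P L HL; [exists P, L; auto|].
  inversion Hp as [|? ? Ha Hp']; subst. cbn [fold_left].
  destruct P as [|b P].
  - cbn [app]. destruct (pchar2_cases (leo A) c a) as [[E H]|[E H]].
    + assert (EL : absorb L a = [a] ++ L).
      { destruct L as [|b L]; auto. inversion HL as [|? ? Hb _]; subst. cbn.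
        destruct (pchar2_cases (leo A) b a) as [[-> _]|[_ H']]; auto.
        exfalso. apply H'. eapply LO_trans; eauto. apply Hb. }
      rewrite EL. cbn [absorb]. rewrite E. apply (IH Hp' [a] L HL).
    + cbn [absorb]. rewrite E. apply (IH Hp' [] (absorb L a)).
      apply absorb_Forall; auto. now apply LO_nlt.
  - cbn [app absorb]. destruct (pchar2 (leo A) b a).
    + apply (IH Hp' (b :: P) L HL).
    + apply (IH Hp' (a :: b :: P) L HL).
Qed.

(** With the last summand at the head, [r ++ p] is the ordinal of [p] plus powers below omega^c, and
    [c :: p] is that of [p] plus omega^c. *)
Lemma cnf_lt c r p : fld A c -> Forall (fld A) p -> Forall (fun x => lto A x c) r ->
  lto (omega_exp A) (code_list (cnf (r ++ p))) (code_list (cnf (c :: p))).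
Proof.
  intros Hc Hp Hr.
  assert (Hlex : lex_lt A (cnf (r ++ p)) (cnf (c :: p))).
  { unfold cnf. rewrite fold_left_app. cbn [fold_left]. change (absorb [] c) with ([] ++ [c]).
    destruct (@absorb_common c p Hc Hp [] (cnf r)) as (P & L & E1 & E2 & HL).
    { now apply cnf_Forall. }
    unfold cnf in E1. cbn [app] in *. rewrite E1, E2. clear - HL.
    induction P as [|a P IH]; cbn; auto.
    destruct HL; cbn; auto. }
  assert (Hr' : Forall (fld A) r).
  { eapply Forall_impl; [|exact Hr]. intros x [Hx _]. now apply (LO_fld HA) in Hx. }
  split.
  - exists (cnf (r ++ p)), (cnf (c :: p)). repeat split; auto; apply cnf_nonincr; auto.
    apply Forall_app. auto.
  - intros E. apply code_list_inj in E. rewrite E in Hlex. now apply lex_lt_irrefl in Hlex.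
Qed.

Lemma cnf_fld p : Forall (fld A) p -> fld (omega_exp A) (code_list (cnf p)).
Proof. intros H. exists (cnf p). split; auto. now apply cnf_nonincr. Qed.

End OmegaExp.

Lemma pchar_ext (P Q : nat -> Prop) : (forall n, P n <-> Q n) -> pchar P = pchar Q.
Proof.
  intros H. extensionality n. unfold pchar.
  destruct (excluded_middle_informative (P n)), (excluded_middle_informative (Q n)); firstorder.
Qed.

Lemma jump_hierarchy_exists Z B : well_founded (lto B) -> exists Y, jump_hierarchy Z B Y.
Proof.
  intros Hwf.
  (* Well-founded recursion gives an earlier column only against a proof of [lto B c b], hence the
     quantified [h]; [pchar_ext] removes it afterwards. *)
  set (F := fun b (rec : forall c, lto B c b -> nat -> Prop) n =>
    fld B b /\ jumpP (join Z (pchar (fun k => exists c m (h : lto B c b),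
      k = cpair c m /\ rec c h m))) n).
  set (col := Fix Hwf (fun _ => nat -> Prop) F).
  assert (Hcol : forall b n, col b n <-> (fld B b /\ jumpP (join Z (pchar (fun k => exists c m,
      k = cpair c m /\ lto B c b /\ col c m))) n)).
  { intros b n. unfold col at 1. rewrite Fix_eq.
    - fold col. unfold F at 1.
      rewrite (@pchar_ext _ (fun k => exists c m, k = cpair c m /\ lto B c b /\ col c m)); [tauto|].
      intros k. split.
      + intros (c & m & h & E & H). exists c, m. auto.
      + intros (c & m & E & h & H). exists c, m, h. auto.
    - intros c f g Hfg. replace g with f; auto. extensionality y. extensionality h. auto. }
  exists (fun k => exists b n, k = cpair b n /\ col b n). split.
  - intros b n Hb (b' & n' & E & H). apply cpair_inj in E. destruct E; subst.
    apply Hcol in H. tauto.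
  - intros b n Hb. transitivity (col b n).
    + split; [|intros; exists b, n; auto].
      intros (b' & n' & E & H). apply cpair_inj in E. destruct E; subst. auto.
    + rewrite Hcol.
      rewrite (@pchar_ext (below B _ b) (fun k => exists c m, k = cpair c m /\ lto B c b /\ col c m));
        [tauto|].
      intros k. split.
      * intros (c & m & E & H & b' & n' & E' & H'). apply cpair_inj in E'. destruct E'; subst.
        exists b', n'. auto.
      * intros (c & m & E & H & H'). exists c, m. repeat split; auto; try apply H. exists c, m. auto.
Qed.

(** * The program computing the sequences *)

(** Inside the recursion the arguments are counter, current state, initial state and parameter;
    [body] receives the state and the parameter. *)
Definition p_iter (body : prog) : prog := PRec (PProj 0) (PComp body [PProj 1; PProj 3]).

Lemma ev_iter Z body (st : nat -> nat) n x :
  (forall i, i < n -> eval Z body [st i; x] (st (S i))) ->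
  eval Z (p_iter body) [n; st 0; x] (st n).
Proof.
  intros H. apply ev_prec with (st := st); [exact (ev_proj Z 0 _)|].
  intros i Hi. eapply ev_comp; [ev|]. auto.
Qed.

Lemma ev_iter_total Z body (F : nat -> nat) n s x :
  (forall r, eval Z body [r; x] (F r)) ->
  eval Z (p_iter body) [n; s; x] (Nat.iter n F s).
Proof. intros H. apply (@ev_iter Z body (fun n => Nat.iter n F s)). intros i _. apply H. Qed.

Definition p_tl : prog := PComp p_csnd [PComp p_pred [PProj 0]].
Definition ctl (c : nat) : nat := csnd (pred c).
Lemma ev_tl Z c x : eval Z p_tl [c; x] (ctl c).
Proof. evs. reflexivity. Qed.
Lemma ev_tl_iter Z n c x : eval Z (p_iter p_tl) [n; c; x] (Nat.iter n ctl c).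
Proof. apply ev_iter_total. intros; apply ev_tl. Qed.
#[export] Hint Resolve ev_tl_iter : evdb.

(** The code of the summand number [p] of the term coded by [c], with a junk value when the term is
    too short. *)
Definition headc (p c : nat) : nat := cfst (pred (Nat.iter p ctl c)).
Definition p_headc : prog :=
  PComp p_cfst [PComp p_pred [PComp (p_iter p_tl) [PProj 0; PProj 1; PZero]]].
Lemma ev_headc Z p c : eval Z p_headc [p; c] (headc p c).
Proof. evs. reflexivity. Qed.
#[export] Hint Resolve ev_headc : evdb.

(** The s-m-n step: a query contains a numeral as a program, so the code of that program has to be
    computed from the number. *)
Definition p_code_cst : prog :=
  PRec PZero
    (PComp p_cpair [p_cst 4; PComp p_cpair [PComp p_cpair [p_cst 1; p_cst 0];
       PComp PSucc [PComp p_cpair [PProj 1; p_cst 0]]]]).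
Lemma ev_code_cst Z n : eval Z p_code_cst [n] (code_prog (p_cst n)).
Proof.
  apply (@ev_prec Z _ _ (fun n => code_prog (p_cst n))); [constructor|].
  intros i _. evs. reflexivity.
Qed.
#[export] Hint Resolve ev_code_cst : evdb.

(* With [e] the code of a test program [M], this is the question whether
   [M [j; cpair e r; m] = 0] for some [j]. *)
Definition query (e r m : nat) : nat :=
  cpair (cpair 4 (cpair (cpair 6 e) (S (cpair (code_prog (p_cst (cpair e r)))
    (S (cpair (cpair 2 0) 0)))))) m.
Definition p_query : prog :=
  PComp p_cpair [PComp p_cpair [p_cst 4; PComp p_cpair [PComp p_cpair [p_cst 6; PProj 0];
    PComp PSucc [PComp p_cpair [PComp p_code_cst [PComp p_cpair [PProj 0; PProj 1]];
      PComp PSucc [PComp p_cpair [PComp p_cpair [p_cst 2; p_cst 0]; p_cst 0]]]]]]; PProj 2].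
Lemma ev_query Z e r m : eval Z p_query [e; r; m] (query e r m).
Proof. evs. reflexivity. Qed.
#[export] Hint Resolve ev_query : evdb.

Lemma least_nat (P : nat -> Prop) : (exists n, P n) ->
  exists n, P n /\ forall m, m < n -> ~ P m.
Proof.
  intros [n Hn]. induction n as [n IH] using lt_wf_ind.
  destruct (classic (exists m, m < n /\ P m)) as [(m & Hm & HP)|H]; [eauto|].
  exists n. split; auto. intros m Hm HP. apply H. eauto.
Qed.

(* Codes are too large to be reduced, so they are only handled through variables;
   an inductive wrapper keeps the equation out of reach of conversion. *)
Inductive is_code (e : nat) (M : prog) : Prop := Is_code : e = code_prog M -> is_code e M.

Lemma has_code M : exists e, is_code e M.
Proof. exists (code_prog M). now constructor. Qed.

(** By [Hv] the test converges for every [j], so the unbounded search halts exactly when a zero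
    exists. Injectivity of codes recovers the searching program from the query. *)
Lemma jumpP_query O M e r m (v : nat -> nat) : is_code e M ->
  (forall j, eval O M [j; cpair e r; m] (v j)) ->
  (jumpP O (query e r m) <-> exists j, v j = 0).
Proof.
  intros He Hv.
  assert (Hq : query e r m = cpair (code_prog (PComp (PMu M) [p_cst (cpair e r); PProj 0])) m)
    by (destruct He; subst e; reflexivity).
  rewrite Hq. clear Hq. split.
  - intros (p & m' & y & E & H). apply cpair_inj in E. destruct E as [E ->].
    apply code_prog_inj in E. subst p. clear He.
    inversion H as [| | | |? ? ? ws ? E1 F1| | |]; subst.
    inversion E1 as [|? ? ? w ws' G1 E2]; subst.
    inversion E2 as [|? ? ? w' ws'' G2 E3]; subst. inversion E3; subst.
    assert (w = cpair e r) by (eapply eval_fun; [exact G1|apply ev_cst]).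
    assert (w' = m') by (eapply eval_fun; [exact G2|exact (ev_proj O 0 [m'])]).
    subst w w'. inversion F1; subst. exists y. eapply eval_fun; eauto.
  - intros H. destruct (least_nat _ H) as (j & Hj & Hmin).
    exists (PComp (PMu M) [p_cst (cpair e r); PProj 0]), m, j.
    split; auto. eapply ev_comp; [ev|].
    constructor.
    + rewrite <- Hj. apply Hv.
    + intros i Hi. exists (pred (v i)). specialize (Hmin i Hi).
      replace (S (pred (v i))) with (v i) by lia. apply Hv.
Qed.

Section Programs.
Variable Z : nat -> nat.
Variable A : LO.
Variable o0 : nat.
Variable g : nat -> nat.
Variables pa pg : prog.
Notation leb := (pchar2 (leo A)).
Hypothesis ev_pa : forall W x y, eval (join Z W) pa [x; y] (leb x y).
Hypothesis ev_pg : forall W n, eval (join Z W) pg [n] (g n).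

Definition cabsorb (s a : nat) : nat :=
  cif s (cif (leb (cfst (pred s)) a) (S (cpair a s)) s) (S (cpair a 0)).
Definition p_absorb : prog :=
  PComp p_if [PProj 0;
    PComp p_if [PComp pa [PComp p_cfst [PComp p_pred [PProj 0]]; PProj 1];
      PComp PSucc [PComp p_cpair [PProj 1; PProj 0]]; PProj 0];
    PComp PSucc [PComp p_cpair [PProj 1; PZero]]].
Lemma ev_absorb W s a : eval (join Z W) p_absorb [s; a] (cabsorb s a).
Proof. evs. reflexivity. Qed.
Hint Resolve ev_absorb : evdb.
Lemma cabsorb_code s a : cabsorb (code_list s) a = code_list (absorb A s a).
Proof.
  unfold cabsorb. destruct s as [|b s]; cbn; auto. rewrite cfst_cpair.
  destruct (leb b a); reflexivity.
Qed.

Definition cnf_step (st : nat) : nat :=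
  cif (cfst st) (cpair (csnd (pred (cfst st))) (cabsorb (csnd st) (cfst (pred (cfst st))))) st.
Definition p_cnf_step : prog :=
  PComp p_if [PComp p_cfst [PProj 0];
    PComp p_cpair [PComp p_csnd [PComp p_pred [PComp p_cfst [PProj 0]]];
      PComp p_absorb [PComp p_csnd [PProj 0]; PComp p_cfst [PComp p_pred [PComp p_cfst [PProj 0]]]]];
    PProj 0].
Lemma ev_cnf_step W st x : eval (join Z W) p_cnf_step [st; x] (cnf_step st).
Proof. evs. reflexivity. Qed.
Lemma ev_cnf_iter W n st x :
  eval (join Z W) (p_iter p_cnf_step) [n; st; x] (Nat.iter n cnf_step st).
Proof. apply ev_iter_total. intros; apply ev_cnf_step. Qed.
Hint Resolve ev_cnf_iter : evdb.
(** The code of a list bounds its length, so [r] itself serves as the number of iterations; steps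
    after the list is exhausted change nothing. *)
Definition ccnf (r : nat) : nat := csnd (Nat.iter r cnf_step (cpair r 0)).
Definition p_cnf : prog :=
  PComp p_csnd [PComp (p_iter p_cnf_step) [PProj 0; PComp p_cpair [PProj 0; PZero]; PZero]].
Lemma ev_cnf W r : eval (join Z W) p_cnf [r] (ccnf r).
Proof. evs. reflexivity. Qed.
Hint Resolve ev_cnf : evdb.

Lemma cnf_iter_code n : forall p s, length p <= n ->
  Nat.iter n cnf_step (cpair (code_list p) (code_list s)) =
  cpair 0 (code_list (fold_left (absorb A) p s)).
Proof.
  induction n as [|n IH]; intros p s Hp.
  - destruct p; [reflexivity|cbn in Hp; lia].
  - rewrite Nat.iter_succ_r. unfold cnf_step at 2. rewrite cfst_cpair, csnd_cpair.
    destruct p as [|a p]; cbn [code_list cif pred].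
    + apply (IH [] s). cbn; lia.
    + rewrite cfst_cpair, csnd_cpair, cabsorb_code. apply (IH p (absorb A s a)). cbn in Hp; lia.
Qed.
Lemma length_code_list p : length p <= code_list p.
Proof. induction p as [|a p IH]; cbn; [lia|]. pose proof (cpair_ge_r a (code_list p)). lia. Qed.
Lemma ccnf_code p : ccnf (code_list p) = code_list (cnf A p).
Proof.
  unfold ccnf. change 0 with (code_list []) at 1.
  rewrite cnf_iter_code by apply length_code_list. apply csnd_cpair.
Qed.

Definition ask (W : nat -> nat) (e r m : nat) : nat := W (cpair (ccnf r) (query e r m)).
Definition p_ask : prog :=
  PComp p_right [PComp p_cpair [PComp p_cnf [PProj 1]; PComp p_query [PProj 0; PProj 1; PProj 2]]].
Lemma ev_ask W e r m : eval (join Z W) p_ask [e; r; m] (ask W e r m).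
Proof. evs. reflexivity. Qed.
Hint Resolve ev_ask : evdb.

(** Reads the [k]-th term of the sequence at [r] off its column: the search asks for each [v]
    whether it is that term. *)
Definition p_val : prog :=
  PMu (PComp p_not [PComp p_ask [PProj 1; PProj 2;
    PComp p_cpair [PZero; PComp p_cpair [PProj 3; PProj 0]]]]).
Lemma ev_val W e r k t :
  (forall v, ask W e r (cpair 0 (cpair k v)) = ceq t v) ->
  eval (join Z W) p_val [e; r; k] t.
Proof.
  intros H. constructor.
  - evs. rewrite H. now rewrite (proj2 (ceq_1 t t)).
  - intros m Hm. exists 0. evs. rewrite H. rewrite (proj2 (ceq_0 t m)); auto. lia.
Qed.

(* The parameter [h] codes an upper bound for indices: [0] is no bound, and
   [S c] is the bound [c]. *)
Definition clow (h d : nat) : nat := cif h (cnot (leb (pred h) d)) 1.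
Definition p_low : prog :=
  PComp p_if [PProj 0; PComp p_not [PComp pa [PComp p_pred [PProj 0]; PProj 1]]; p_cst 1].
Lemma ev_low W h d : eval (join Z W) p_low [h; d] (clow h d).
Proof. evs. reflexivity. Qed.
Hint Resolve ev_low : evdb.

Definition cmax (x y : nat) : nat := cif (leb x y) y x.
Definition p_max : prog := PComp p_if [PComp pa [PProj 0; PProj 1]; PProj 1; PProj 0].
Lemma ev_max W x y : eval (join Z W) p_max [x; y] (cmax x y).
Proof. evs. reflexivity. Qed.
Hint Resolve ev_max : evdb.

(** The state pairs the code of a term with the largest index met so far. Tag [1] marks an atom
    phi_d(u); if [d] is below the bound, the step moves from the term to [u]. *)
Definition strip_step (h st : nat) : nat :=
  let a := cfst (pred (cfst st)) in
  cif (ceq (cfst a) 1)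
    (cif (clow h (cfst (csnd a)))
      (cpair (csnd (csnd a)) (cmax (csnd st) (cfst (csnd a)))) st) st.
Definition p_strip_step : prog :=
  let a := PComp p_cfst [PComp p_pred [PComp p_cfst [PProj 0]]] in
  PComp p_if [PComp p_eq [PComp p_cfst [a]; p_cst 1];
    PComp p_if [PComp p_low [PProj 1; PComp p_cfst [PComp p_csnd [a]]];
      PComp p_cpair [PComp p_csnd [PComp p_csnd [a]];
         PComp p_max [PComp p_csnd [PProj 0]; PComp p_cfst [PComp p_csnd [a]]]];
      PProj 0];
    PProj 0].
Lemma ev_strip_step W h st : eval (join Z W) p_strip_step [st; h] (strip_step h st).
Proof. unfold p_strip_step. cbv zeta. evs. reflexivity. Qed.
Lemma ev_strip_iter W n st h :
  eval (join Z W) (p_iter p_strip_step) [n; st; h] (Nat.iter n (strip_step h) st).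
Proof. apply ev_iter_total. intros; apply ev_strip_step. Qed.
Hint Resolve ev_strip_iter : evdb.

Definition strip_run (h n : nat) : nat := Nat.iter n (strip_step h) (cpair n o0).
Definition p_strip_run : prog :=
  PComp (p_iter p_strip_step) [PProj 1; PComp p_cpair [PProj 1; p_cst o0]; PProj 0].
Lemma ev_strip_run W h n : eval (join Z W) p_strip_run [h; n] (strip_run h n).
Proof. evs. reflexivity. Qed.
Hint Resolve ev_strip_run : evdb.

Definition p_push : prog := PComp PSucc [PComp p_cpair [PProj 1; PProj 0]].
Lemma ev_push_iter W n r d :
  eval (join Z W) (p_iter p_push) [n; r; d] (Nat.iter n (fun r => S (cpair d r)) r).
Proof. apply ev_iter_total. intros. evs. reflexivity. Qed.
Hint Resolve ev_push_iter : evdb.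

(** Adds omega^d exactly [n + 1] times, where [d] is the largest index stripped from the term coded
    by [n]. The code is a crude bound on the number of levels of the tower above that term. *)
Definition extend (h n r : nat) : nat :=
  Nat.iter (S n) (fun r => S (cpair (csnd (strip_run h n)) r)) r.
Definition p_extend : prog :=
  PComp (p_iter p_push) [PComp PSucc [PProj 1]; PProj 2;
    PComp p_csnd [PComp p_strip_run [PProj 0; PProj 1]]].
Lemma ev_extend W h n r : eval (join Z W) p_extend [h; n; r] (extend h n r).
Proof. evs. reflexivity. Qed.
Hint Resolve ev_extend : evdb.

(** From a sum [r] to the next one: only the first term of the sequence at [r] is needed to know
    which powers to add. *)
Definition p_lim_step : prog :=
  PComp p_extend [PComp p_csnd [PProj 1];
    PComp p_val [PComp p_cfst [PProj 1]; PProj 0; PZero]; PProj 0].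
Definition p_lim : prog :=
  PComp p_cfst [PComp p_pred [PComp p_cfst [PComp p_strip_run [PProj 2;
    PComp p_val [PProj 0;
      PComp (p_iter p_lim_step) [PProj 3; PProj 1; PComp p_cpair [PProj 0; PProj 2]];
      PZero]]]]].
Lemma ev_lim W e h k (r t : nat -> nat) :
  (forall i v, ask W e (r i) (cpair 0 (cpair 0 v)) = ceq (t i) v) ->
  (forall i, r (S i) = extend h (t i) (r i)) ->
  eval (join Z W) p_lim [e; r 0; h; k] (cfst (pred (cfst (strip_run h (t k))))).
Proof.
  intros Ht Hr.
  assert (Hval : forall i, eval (join Z W) p_val [e; r i; 0] (t i)).
  { intros i. apply ev_val. intros. apply Ht. }
  assert (Hit : eval (join Z W) (p_iter p_lim_step) [k; r 0; cpair e h] (r k)).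
  { apply ev_iter. intros i _. rewrite Hr. unfold p_lim_step.
    assert (Hval' : eval (join Z W) p_val [cfst (cpair e h); r i; 0] (t i)).
    { rewrite cfst_cpair. apply Hval. }
    evs. now rewrite csnd_cpair. }
  evs. reflexivity.
Qed.

(* The state [cpair n p] of the search for a decreasing sequence of heads:
   from the [n]-th term on, only the summands from the [p]-th on change. *)
Definition jump_step (W : nat -> nat) (e r st : nat) : nat :=
  cif (ask W e r (cpair 1 st)) (cpair (S (cfst st)) (csnd st)) (cpair (cfst st) (S (csnd st))).
Definition p_jump_step : prog :=
  PComp p_if [PComp p_ask [PComp p_cfst [PProj 1]; PComp p_csnd [PProj 1];
      PComp p_cpair [p_cst 1; PProj 0]];
    PComp p_cpair [PComp PSucc [PComp p_cfst [PProj 0]]; PComp p_csnd [PProj 0]];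
    PComp p_cpair [PComp p_cfst [PProj 0]; PComp PSucc [PComp p_csnd [PProj 0]]]].
Lemma ev_jump_step W e r st :
  eval (join Z W) p_jump_step [st; cpair e r] (jump_step W e r st).
Proof. evs. rewrite cfst_cpair, csnd_cpair. reflexivity. Qed.
Lemma ev_jump_iter W n st e r :
  eval (join Z W) (p_iter p_jump_step) [n; st; cpair e r] (Nat.iter n (jump_step W e r) st).
Proof. apply ev_iter_total. intros; apply ev_jump_step. Qed.
Hint Resolve ev_jump_iter : evdb.

Definition jump_state (W : nat -> nat) (e r i : nat) : nat := Nat.iter i (jump_step W e r) (cpair 0 0).
Definition p_jump_state : prog := PComp (p_iter p_jump_step) [PProj 1; p_cst (cpair 0 0); PProj 0].
Lemma ev_jump_state W e r i :
  eval (join Z W) p_jump_state [cpair e r; i] (jump_state W e r i).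
Proof. evs. reflexivity. Qed.
Hint Resolve ev_jump_state : evdb.

Definition jump_out (W : nat -> nat) (e r : nat) (a : nat -> nat) (i : nat) : nat :=
  headc (csnd (jump_state W e r i)) (a (cfst (jump_state W e r i))).
Definition p_jump_out : prog :=
  PComp p_headc [PComp p_csnd [PComp p_jump_state [PProj 0; PProj 1]];
    PComp p_val [PComp p_cfst [PProj 0]; PComp p_csnd [PProj 0];
       PComp p_cfst [PComp p_jump_state [PProj 0; PProj 1]]]].
(** The leading atoms read at successive states may repeat; this search jumps to the next state
    where the atom is different. *)
Definition p_jump_next : prog :=
  PComp p_add [PProj 0;
    PMu (PComp p_eq [PComp p_jump_out [PProj 2; PComp p_add [PProj 1; PProj 0]];
                     PComp p_jump_out [PProj 2; PProj 1]])].
Definition p_jump : prog :=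
  PComp p_jump_out [PComp p_cpair [PProj 0; PProj 1];
    PComp (p_iter p_jump_next) [PProj 2; PZero; PComp p_cpair [PProj 0; PProj 1]]].

Lemma ev_jump W e r k (a ix : nat -> nat) :
  (forall i v, ask W e r (cpair 0 (cpair i v)) = ceq (a i) v) ->
  ix 0 = 0 ->
  (forall k, ix k <= ix (S k) /\ jump_out W e r a (ix (S k)) <> jump_out W e r a (ix k) /\
     forall i, ix k <= i < ix (S k) -> jump_out W e r a i = jump_out W e r a (ix k)) ->
  eval (join Z W) p_jump [e; r; k] (jump_out W e r a (ix k)).
Proof.
  intros Ha H0 Hix.
  assert (Hout : forall i, eval (join Z W) p_jump_out [cpair e r; i] (jump_out W e r a i)).
  { intros i.
    assert (Hval : eval (join Z W) p_val [cfst (cpair e r); csnd (cpair e r);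
       cfst (jump_state W e r i)] (a (cfst (jump_state W e r i)))).
    { rewrite cfst_cpair, csnd_cpair. apply ev_val. intros. apply Ha. }
    evs. reflexivity. }
  assert (Hit : eval (join Z W) (p_iter p_jump_next) [k; 0; cpair e r] (ix k)).
  { rewrite <- H0. apply ev_iter. intros i _. destruct (Hix i) as (H1 & H2 & H3).
    apply ev_comp with [ix i; ix (S i) - ix i].
    - constructor; [ev|]. constructor; [|constructor]. constructor.
      + evs. apply ceq_0. replace (ix i + (ix (S i) - ix i)) with (ix (S i)) by lia. auto.
      + intros m Hm. exists 0. evs. apply ceq_1. apply H3. lia.
    - evs. lia. }
  evs. reflexivity.
Qed.

Definition ccoll (c a : nat) : nat :=
  cif (ceq (cfst a) 1)
    (cif (ceq (cfst (csnd a)) c) (csnd (csnd a)) (S (cpair a 0))) (S (cpair a 0)).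
Definition p_coll : prog :=
  let s := PComp PSucc [PComp p_cpair [PProj 1; PZero]] in
  PComp p_if [PComp p_eq [PComp p_cfst [PProj 1]; p_cst 1];
    PComp p_if [PComp p_eq [PComp p_cfst [PComp p_csnd [PProj 1]]; PProj 0];
      PComp p_csnd [PComp p_csnd [PProj 1]]; s]; s].
Lemma ev_coll O c a : eval O p_coll [c; a] (ccoll c a).
Proof. unfold p_coll. cbv zeta. evs. reflexivity. Qed.
Hint Resolve ev_coll : evdb.

(** There is no recursive call: everything about the sequence at the tail is obtained from the
    oracle. The least index [o0] has no smaller index to build towers with and uses the jump search.
    The index [S k] drops the first atom. Branching is lazy because the branches not taken may
    diverge. *)
Definition p_seq : prog :=
  let c := PComp p_cfst [PComp p_pred [PProj 1]] in
  let r := PComp p_csnd [PComp p_pred [PProj 1]] in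
  p_lif 3 (PComp p_not [PProj 1]) (PComp pg [PProj 2])
    (p_lif 3 (PComp p_eq [c; p_cst o0])
      (PComp p_coll [c; PComp p_jump [PProj 0; r; PComp PSucc [PProj 2]]])
      (PComp p_coll [c; PComp p_lim [PProj 0; r; PComp PSucc [c]; PComp PSucc [PProj 2]]])).

Lemma ev_seq_nil W e k : eval (join Z W) p_seq [e; 0; k] (g k).
Proof. apply ev_lif_true; auto; evs; reflexivity. Qed.

Lemma ev_seq_jump W e r k y :
  eval (join Z W) p_jump [e; r; S k] y ->
  eval (join Z W) p_seq [e; S (cpair o0 r); k] (ccoll o0 y).
Proof.
  intros H. apply ev_lif_false; auto; [evs; reflexivity|].
  apply ev_lif_true; auto.
  - evs. cbn [pred]. rewrite cfst_cpair. now apply ceq_1.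
  - assert (H' : eval (join Z W) p_jump [e; csnd (pred (S (cpair o0 r))); S k] y).
    { cbn [pred]. now rewrite csnd_cpair. }
    evs. cbn [pred]. now rewrite cfst_cpair.
Qed.

Lemma ev_seq_lim W e c r k y : c <> o0 ->
  eval (join Z W) p_lim [e; r; S c; S k] y ->
  eval (join Z W) p_seq [e; S (cpair c r); k] (ccoll c y).
Proof.
  intros Hc H. apply ev_lif_false; auto; [evs; reflexivity|].
  apply ev_lif_false; auto.
  - evs. cbn [pred]. rewrite cfst_cpair. now apply ceq_0.
  - assert (H' : eval (join Z W) p_lim
      [e; csnd (pred (S (cpair c r))); S (cfst (pred (S (cpair c r)))); S k] y).
    { cbn [pred]. now rewrite cfst_cpair, csnd_cpair. }
    evs. cbn [pred]. now rewrite cfst_cpair.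
Qed.

(** Two kinds of question, told apart by [cfst m]. Kind [0] has a zero iff a given term has a given
    value. Any other kind has a zero in [j] iff the selected summand differs [j] terms later. *)
Definition test (a : nat -> nat) (j m : nat) : nat :=
  cif (cfst m)
    (ceq (headc (csnd (csnd m)) (a (cfst (csnd m) + j)))
         (headc (csnd (csnd m)) (a (cfst (csnd m)))))
    (cnot (ceq (a (cfst (csnd m))) (csnd (csnd m)))).
(** Self-reference through an argument: [e] is read from the input and given to [p_seq], and it will
    be instantiated with the code of this very program. *)
Definition p_test : prog :=
  let e := PComp p_cfst [PProj 1] in
  let r := PComp p_csnd [PProj 1] in
  let n := PComp p_cfst [PComp p_csnd [PProj 2]] in
  let p := PComp p_csnd [PComp p_csnd [PProj 2]] in
  PComp p_if [PComp p_cfst [PProj 2];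
    PComp p_eq [PComp p_headc [p; PComp p_seq [e; r; PComp p_add [n; PProj 0]]];
                PComp p_headc [p; PComp p_seq [e; r; n]]];
    PComp p_not [PComp p_eq [PComp p_seq [e; r; n]; p]]].
Lemma ev_test O' e r j m a :
  (exists W, O' = join Z W) ->
  (forall k, eval O' p_seq [e; r; k] (a k)) ->
  eval O' p_test [j; cpair e r; m] (test a j m).
Proof.
  intros [W ->] H.
  assert (H' : forall k, eval (join Z W) p_seq [cfst (cpair e r); csnd (cpair e r); k] (a k)).
  { now rewrite cfst_cpair, csnd_cpair. }
  unfold p_test. cbv zeta. evs. reflexivity.
Qed.

Definition column_ok (W : nat -> nat) (O' : nat -> nat) (c : nat) : Prop :=
  forall n, (W (cpair c n) = 1 /\ jumpP O' n) \/ (W (cpair c n) = 0 /\ ~ jumpP O' n).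

Lemma ask_cases W V e r m a :
  is_code e p_test ->
  column_ok W (join Z V) (ccnf r) ->
  (forall k, eval (join Z V) p_seq [e; r; k] (a k)) ->
  (ask W e r m = 1 /\ exists j, test a j m = 0) \/
  (ask W e r m = 0 /\ forall j, test a j m <> 0).
Proof.
  intros He HW Ha.
  assert (HQ := @jumpP_query (join Z V) p_test e r m (fun j => test a j m) He
    (fun j => @ev_test _ _ _ _ _ _ (ex_intro _ V eq_refl) Ha)).
  clear He.
  unfold ask. destruct (HW (query e r m)) as [[-> H]|[-> H]].
  - left. tauto.
  - right. split; auto. intros j Hj. apply H, HQ. eauto.
Qed.

Lemma ask_val W V e r k v a :
  is_code e p_test ->
  column_ok W (join Z V) (ccnf r) ->
  (forall k, eval (join Z V) p_seq [e; r; k] (a k)) ->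
  ask W e r (cpair 0 (cpair k v)) = ceq (a k) v.
Proof.
  intros He HW Ha.
  destruct (ask_cases (cpair 0 (cpair k v)) a He HW Ha) as [[-> [j Hj]]|[-> Hj]];
    unfold test in *; [|specialize (Hj 0)]; rewrite cfst_cpair, !csnd_cpair, cfst_cpair in Hj;
    cbn [cif] in Hj; unfold ceq in *; destruct (a k =? v); cbn [cnot] in Hj; congruence.
Qed.

Lemma ask_jump W V e r st a :
  is_code e p_test ->
  column_ok W (join Z V) (ccnf r) ->
  (forall k, eval (join Z V) p_seq [e; r; k] (a k)) ->
  (ask W e r (cpair 1 st) = 1 /\
     exists j, headc (csnd st) (a (cfst st + j)) <> headc (csnd st) (a (cfst st))) \/
  (ask W e r (cpair 1 st) = 0 /\
     forall j, headc (csnd st) (a (cfst st + j)) = headc (csnd st) (a (cfst st))).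
Proof.
  intros He HW Ha.
  destruct (ask_cases (cpair 1 st) a He HW Ha) as [[-> [j Hj]]|[-> Hj]]; unfold test in Hj;
    setoid_rewrite cfst_cpair in Hj; setoid_rewrite csnd_cpair in Hj; cbn [cif] in Hj;
    clear He.
  - left. split; auto. exists j. now apply ceq_0.
  - right. split; auto. intros j. specialize (Hj j). unfold ceq in Hj.
    destruct (Nat.eqb_spec (headc (csnd st) (a (cfst st + j))) (headc (csnd st) (a (cfst st)))); auto.
    congruence.
Qed.

End Programs.

(** * Collapsing and towers *)

Lemma code_inj :
  (forall t t', code_term t = code_term t' -> t = t') /\
  (forall a a', code_atom a = code_atom a' -> a = a').
Proof.
  apply term_atom_ind.
  - intros [|a r] H; cbn in H; [auto|discriminate].
  - intros a IHa r IHr [|a' r'] H; cbn in H; [discriminate|].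
    injection H as H. apply cpair_inj in H. destruct H. f_equal; auto.
  - intros x [x'|d s] H; cbn in H; apply cpair_inj in H; destruct H; [|discriminate].
    now subst.
  - intros d s IH [x'|d' s'] H; cbn in H; apply cpair_inj in H; destruct H as [H1 H2]; [discriminate|].
    apply cpair_inj in H2. destruct H2. f_equal; auto.
Qed.
Lemma code_atom_inj a a' : code_atom a = code_atom a' -> a = a'.
Proof. apply code_inj. Qed.

Lemma head_ind (P : term -> Prop) :
  P TZero -> (forall x r, P (TSum (AConst x) r)) ->
  (forall d u r, P u -> P (TSum (APhi d u) r)) -> forall t, P t.
Proof.
  intros H0 H1 H2. fix IH 1. intros [|[x|d u] r]; [exact H0|apply H1|apply H2, IH].
Qed.

Section Collapse.
Variables A X : LO.
Hypothesis HA : is_LO A.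
Hypothesis HX : is_LO X.
Variable o0 : nat.
Notation leb := (pchar2 (leo A)).
Notation low := (clow A).
Notation le := (le_t A X).
Notation lt := (lt_t A X).
Notation nf := (nf_t A X).
Notation nfa := (nf_a A X).

(** These are the atoms closed under phi_d for all [d] below the bound. *)
Definition high (h : nat) (a : atom) : Prop :=
  match a with APhi d _ => low h d = 0 | AConst _ => True end.

Definition coll (c : nat) (a : atom) : term :=
  match a with
  | APhi d u => if d =? c then u else single a
  | AConst _ => single a
  end.

Lemma code_coll c a : ccoll c (code_atom a) = code_term (coll c a).
Proof.
  unfold ccoll. destruct a as [x|d u]; cbn [code_atom coll].
  - rewrite cfst_cpair. reflexivity.
  - rewrite cfst_cpair, !csnd_cpair, cfst_cpair. unfold ceq. cbn [Nat.eqb cif].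
    destruct (d =? c); reflexivity.
Qed.

Lemma coll_nf c a : nfa a -> nf (coll c a).
Proof.
  destruct a as [x|d u]; cbn [coll].
  - intros H. now apply nf_single.
  - intros H. destruct (d =? c); [apply H|now apply nf_single].
Qed.

Lemma clow_S c d : low (S c) d = 0 -> leo A c d.
Proof.
  unfold clow. cbn [cif pred].
  destruct (pchar2_cases (leo A) c d) as [[-> H]|[-> H]]; auto. discriminate.
Qed.
Lemma clow_S_low c d : fld A c -> fld A d -> low (S c) d <> 0 -> lto A d c.
Proof.
  intros Hc Hd. unfold clow. cbn [cif pred].
  destruct (pchar2_cases (leo A) c d) as [[-> H]|[-> H]]; [now intros []|].
  intros _. now apply LO_nlt.
Qed.
Lemma clow_S_lt c d : lto A d c -> low (S c) d <> 0.
Proof.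
  unfold clow. cbn [cif pred]. intros [H1 H2].
  destruct (pchar2_cases (leo A) c d) as [[-> H]|[-> H]]; [|discriminate].
  exfalso. apply H2. now apply (LO_antisym HA).
Qed.

(** On these atoms [coll c] inverts phi_c: atoms above level [c] are its fixed points. A strictly
    increasing function has a strictly increasing inverse; the proof uses totality to argue by
    contraposition. *)
Lemma coll_lt c a b : nfa a -> nfa b -> high (S c) a -> high (S c) b ->
  lt (single a) (single b) -> lt (coll c a) (coll c b).
Proof.
  intros Na Nb Ha Hb H.
  apply lt_iff; auto using coll_nf. apply lt_iff in H; auto; try now apply nf_single.
  intros Hle. apply H. clear H.
  assert (Hlev : forall a, nfa a -> high (S c) a ->
    (exists u, a = APhi c u /\ coll c a = u) \/
    (coll c a = single a /\ forall u, lev_lt A (APhi c u) a)).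
  { intros [x|d u] Na1 Ha1; cbn [coll]; [right; split; auto; intros; exact I|].
    destruct (Nat.eqb_spec d c) as [->|Hne]; [left; eauto|right; split; auto].
    intros w. split; auto. now apply clow_S. }
  destruct (Hlev b Nb Hb) as [(u & -> & E)|[E Hu]]; rewrite E in Hle; clear E;
    destruct (Hlev a Na Ha) as [(v & -> & E)|[E Hv]]; rewrite E in Hle; clear E; auto.
  - apply le_atom_eq; simpl; auto.
  - apply (le_atom_lt X HA); [apply Hv|exact Hle].
  - apply (le_atom_gt X HA); [apply Hu|exact Hle].
Qed.

Lemma lt_sum a r b r' : nf (TSum a r) -> nf (TSum b r') ->
  lt (single a) (single b) -> lt (TSum a r) (TSum b r').
Proof.
  intros H1 H2 H. split.
  - apply le_sum_iff; auto.
  - intros E. injection E as -> ->. now apply H.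
Qed.

Fixpoint strip (h : nat) (t : term) : term :=
  match t with
  | TZero => TZero
  | TSum a r =>
      match a with
      | AConst _ => t
      | APhi d u => match low h d with 0 => t | S _ => strip h u end
      end
  end.
Fixpoint strip_max (h : nat) (t : term) (m : nat) : nat :=
  match t with
  | TZero => m
  | TSum a r =>
      match a with
      | AConst _ => m
      | APhi d u => match low h d with 0 => m | S _ => strip_max h u (cmax A m d) end
      end
  end.

Lemma code_arg_lt d u r : code_term u < code_term (TSum (APhi d u) r).
Proof.
  cbn [code_term code_atom].
  pose proof (cpair_ge_l (cpair 1 (cpair d (code_term u))) (code_term r)).
  pose proof (cpair_ge_r 1 (cpair d (code_term u))).
  pose proof (cpair_ge_r d (code_term u)). lia.
Qed.

Lemma iter_fixpoint (F : nat -> nat) x n : F x = x -> Nat.iter n F x = x.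
Proof. intros H. induction n as [|n IH]; [reflexivity|]. change (F (Nat.iter n F x) = x). now rewrite IH. Qed.

Lemma strip_iter_code h n : forall t m, code_term t <= n ->
  Nat.iter n (strip_step A h) (cpair (code_term t) m) =
  cpair (code_term (strip h t)) (strip_max h t m).
Proof.
  induction n as [|n IH]; intros t m Hn.
  - destruct t; [reflexivity|cbn in Hn; lia].
  - assert (Hfix : forall t, (strip_step A h (cpair (code_term t) m) = cpair (code_term t) m) ->
      Nat.iter (S n) (strip_step A h) (cpair (code_term t) m) = cpair (code_term t) m).
    { intros. now apply iter_fixpoint. }
    destruct t as [|[x|d u] r].
    + apply (Hfix TZero). unfold strip_step. rewrite cfst_cpair. reflexivity.
    + apply (Hfix (TSum (AConst x) r)). unfold strip_step.
      rewrite cfst_cpair. cbn [code_term code_atom pred]. now rewrite !cfst_cpair.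
    + assert (Hstep : strip_step A h (cpair (code_term (TSum (APhi d u) r)) m) =
        cif (low h d) (cpair (code_term u) (cmax A m d)) (cpair (code_term (TSum (APhi d u) r)) m)).
      { unfold strip_step. rewrite cfst_cpair, csnd_cpair. cbn [code_term code_atom pred].
        rewrite !cfst_cpair, !csnd_cpair, cfst_cpair. reflexivity. }
      cbn [strip strip_max]. destruct (low h d) eqn:E; cbn [cif] in Hstep.
      * now apply Hfix.
      * rewrite Nat.iter_succ_r, Hstep. apply IH.
        pose proof (code_arg_lt d u r). lia.
Qed.

Lemma strip_run_code h t :
  strip_run A o0 h (code_term t) = cpair (code_term (strip h t)) (strip_max h t o0).
Proof. now apply strip_iter_code. Qed.

Lemma strip_nf h t : nf t -> nf (strip h t).
Proof.
  induction t as [|x r|d u r IH] using head_ind; intros H; auto.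
  cbn [strip]. destruct (low h d); auto. apply IH. apply H.
Qed.

(** The level of the atom reached exceeds every stripped index, so comparing it with a stripped
    phi_d(u) amounts to comparing it with [u]. *)
Lemma strip_high h t a r : nf t -> strip h t = TSum a r ->
  high h a /\ le (single a) t.
Proof.
  induction t as [|x s|d u s IH] using head_ind; intros H E; [discriminate| |].
  - cbn in E. injection E as <- <-. split; [exact I|].
    apply le_single_sum. apply le_refl; auto. apply nf_single, H.
  - cbn [strip] in E. destruct (low h d) eqn:Ed.
    + injection E as <- <-. split; [exact Ed|].
      apply le_single_sum. apply le_refl; auto. apply nf_single, H.
    + destruct IH as [Ha Hle]; auto; [apply H|]. split; auto.
      apply le_single_sum. apply le_atom_gt; auto.
      destruct a as [x|d' u']; cbn; auto. cbn in Ha.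
      assert (Hn : nf (strip h u)) by (apply strip_nf, H). rewrite E in Hn.
      destruct h as [|c]; [discriminate Ha|].
      assert (Hc := clow_S _ _ Ha). destruct (LO_fld HA Hc) as [Fc _].
      assert (Hd : lto A d c).
      { apply clow_S_low; auto; [apply H|congruence]. }
      exact (LO_lt_le_trans HA Hd Hc).
Qed.

Hypothesis Hmin : forall d, fld A d -> leo A o0 d.
Hypothesis Ho0 : fld A o0.

(** The least nonzero term, written with the least index. *)
Definition one : term := single (APhi o0 TZero).
Definition succ_head (t : term) : term :=
  match t with TZero => one | TSum a _ => TSum a one end.
Definition tower (d m : nat) (t : term) : term := Nat.iter m (fun s => single (APhi d s)) t.

Lemma one_nf : nf one.
Proof. apply nf_single. simpl. auto. Qed.

Lemma succ_head_nf t : nf t -> nf (succ_head t).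
Proof.
  destruct t as [|a r]; [intros; apply one_nf|]. intros (Ha & _). cbn [succ_head].
  split; [auto|]. split; [apply one_nf|].
  destruct a as [x|d u]; cbn in Ha.
  - apply le_phi_const. constructor.
  - destruct (Nat.eq_dec d o0) as [->|Hne]; [apply le_phi_eq; constructor|].
    apply le_phi_lt; [|constructor]. split; auto. apply Hmin, Ha.
Qed.

(** This is why towers start at x + 1 and not at x: phi_d(x) would reduce to x for an atom x of
    higher level, while a sum of two atoms is always an irreducible argument. *)
Lemma phi_arg_ok_succ_head d t : fld A d -> phi_arg_ok A d (succ_head t).
Proof.
  intros Hd. assert (H : ~ lto A d o0).
  { intros [H1 H2]. apply H2, (LO_antisym HA); auto. }
  destruct t as [|[x|d' u] r]; simpl; auto.
Qed.

Lemma tower_nf d m t : fld A d -> nf t -> nf (tower d m (succ_head t)).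
Proof.
  intros Hd Ht. induction m as [|m IH]; [now apply succ_head_nf|].
  apply nf_single. cbn. split; auto. split; auto.
  destruct m; [now apply phi_arg_ok_succ_head|].
  intros [_ H]. auto.
Qed.

(** The atom [a] is closed under phi_d, so a tower below [a] would bring its base a + 1 below
    [a]. *)
Lemma lt_tower_high d m a r : fld A d -> nf (TSum a r) ->
  lev_lt A (APhi d TZero) a -> lt (single a) (tower d m (TSum a one)).
Proof.
  intros Hd Hn Hl. assert (Na : nf (single a)) by apply nf_single, Hn.
  induction m as [|m IH].
  - split; [|discriminate]. apply le_sum_iff; auto.
    + apply (succ_head_nf (TSum a r)); auto.
    + right. split; auto. constructor.
  - assert (Nt := @tower_nf d m (TSum a r) Hd Hn). cbn [succ_head] in Nt.
    assert (Nt' := @tower_nf d (S m) (TSum a r) Hd Hn). cbn [succ_head] in Nt'.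
    apply lt_iff in IH; auto. apply lt_iff; auto.
    intros H. apply IH. apply (le_atom_lt X HA) in H; auto.
Qed.

Lemma cmax_ge m d : fld A m -> fld A d ->
  fld A (cmax A m d) /\ leo A m (cmax A m d) /\ leo A d (cmax A m d).
Proof.
  intros Hm Hd. unfold cmax. destruct (pchar2_cases (leo A) m d) as [[-> H]|[-> H]]; cbn.
  - repeat split; auto. apply LO_refl; auto.
  - destruct (LO_total HA Hm Hd); [tauto|]. repeat split; auto. apply LO_refl; auto.
Qed.

Lemma strip_max_ge h t : forall m, nf t -> fld A m ->
  fld A (strip_max h t m) /\ leo A m (strip_max h t m).
Proof.
  induction t as [|x r|d u r IH] using head_ind; intros m H Hm; cbn [strip_max];
    try (split; auto; apply LO_refl; now auto).
  destruct (low h d); [split; auto; apply LO_refl; now auto|].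
  destruct (@cmax_ge m d) as (H1 & H2 & H3); auto; [apply H|].
  destruct (IH (cmax A m d)) as [H4 H5]; auto; [apply H|].
  split; auto. eapply LO_trans; eauto.
Qed.

Lemma strip_max_low h t : forall m, nf t -> low h m <> 0 -> low h (strip_max h t m) <> 0.
Proof.
  induction t as [|x r|d u r IH] using head_ind; intros m H Hm; cbn [strip_max]; auto.
  destruct (low h d) eqn:E; auto. apply IH; [apply H|].
  unfold cmax. destruct (leb m d); cbn; congruence.
Qed.

(* Following the first summands below the bound [h], with [d] the largest
   index on the way, leaves [t] below d-towers over the next successor. *)
Lemma lt_tower h d : fld A d -> low h d <> 0 ->
  forall t m0 m, nf t -> fld A m0 -> leo A (strip_max h t m0) d -> code_term t <= m ->
  lt t (tower d (S m) (succ_head (strip h t))).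
Proof.
  intros Hd Hlow t. induction t as [|x r|d' u r IH] using head_ind; intros m0 m H Hm0 Hmax Hm.
  - split; [constructor|discriminate].
  - apply lt_sum; auto; [apply (@tower_nf d (S m)); auto|].
    apply (@lt_tower_high d (S m) _ r); auto. exact I.
  - assert (Nu : nf u) by apply H. assert (Fd' : fld A d') by apply H.
    assert (Nall := @tower_nf d (S m) _ Hd (strip_nf h _ H)).
    apply lt_sum; auto. clear Nall.
    cbn [strip strip_max] in *. destruct (low h d') eqn:E.
    + apply (@lt_tower_high d (S m) _ r); auto. simpl.
      destruct h as [|c]; [discriminate E|].
      assert (Hc := clow_S _ _ E). destruct (LO_fld HA Hc) as [Fc _].
      assert (Hdc : lto A d c) by now apply clow_S_low.
      exact (LO_lt_le_trans HA Hdc Hc).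
    + destruct (@cmax_ge m0 d') as (H1 & H2 & H3); auto.
      destruct (@strip_max_ge h u (cmax A m0 d')) as [H4 H5]; auto.
      assert (Hd'd : leo A d' d) by (eapply LO_trans; [auto| |eapply LO_trans; eauto]; eauto).
      pose proof (code_arg_lt d' u r).
      destruct m as [|m]; [lia|].
      assert (Hs := strip_nf h _ Nu).
      assert (N1 := @tower_nf d (S m) _ Hd Hs).
      assert (N2 := @tower_nf d (S (S m)) _ Hd Hs).
      assert (Ns : nf (single (APhi d' u))) by apply nf_single, H.
      apply lt_iff; auto. intros Hle.
      (* An index equal to [d] uses up one level of the tower; for a smaller index the whole tower
         remains to be compared with [u]. *)
      destruct (Nat.eq_dec d' d) as [->|Hne].
      * apply (le_atom_eq A X) in Hle; [|reflexivity].
        specialize (IH (cmax A m0 d) m Nu H1 Hmax ltac:(lia)).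
        apply lt_iff in IH; auto.
      * apply (le_atom_gt X HA) in Hle; [|split; auto].
        specialize (IH (cmax A m0 d') (S m) Nu H1 Hmax ltac:(lia)).
        apply lt_iff in IH; auto.
Qed.

Lemma lt_succ_head w t : nf w -> nf t -> lt w (succ_head t) ->
  match t with
  | TZero => w = TZero
  | TSum a _ => le w (single a)
  end.
Proof.
  intros Nw Nt H. assert (Ns := succ_head_nf _ Nt).
  assert (Hone : forall v, nf v -> lt v one -> v = TZero).
  { intros [|b v] Nv Hv; auto. exfalso.
    apply lt_iff in Hv; auto using one_nf. apply Hv.
    (* That b + 1 is in normal form contains the inequality 1 <= b. *)
    apply le_single_sum. destruct (succ_head_nf _ Nv) as (_ & _ & H1). exact H1. }
  destruct t as [|a r]; cbn [succ_head] in *; [now apply Hone|].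
  destruct w as [|b v]; [constructor|].
  assert (Na : nf (single a)) by apply nf_single, Nt.
  destruct H as [H1 H2]. apply le_sum_iff in H1; auto.
  destruct H1 as [H1|[-> H1]].
  - apply (@lt_sum b v a TZero Nw Na H1).
  - assert (v = TZero); [|subst; apply le_refl; auto].
    apply Hone; [apply Nw|]. split; auto. intros ->. auto.
Qed.

End Collapse.

(** * Descending sequences of leading summands *)

Definition ttl (t : term) : term := match t with TZero => TZero | TSum _ r => r end.
Definition thd (t : term) : atom := match t with TZero => AConst 0 | TSum a _ => a end.
Definition tdrop (p : nat) (t : term) : term := Nat.iter p ttl t.

Lemma ttl_code t : code_term (ttl t) = ctl (code_term t).
Proof. destruct t as [|a r]; [reflexivity|]. unfold ctl. cbn. now rewrite csnd_cpair. Qed.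
Lemma tdrop_code p t : code_term (tdrop p t) = Nat.iter p ctl (code_term t).
Proof.
  induction p as [|p IH]; [reflexivity|].
  change (code_term (ttl (tdrop p t)) = ctl (Nat.iter p ctl (code_term t))).
  now rewrite ttl_code, IH.
Qed.
Lemma headc_code p t : tdrop p t <> TZero ->
  headc p (code_term t) = code_atom (thd (tdrop p t)).
Proof.
  intros H. unfold headc. rewrite <- tdrop_code.
  destruct (tdrop p t) as [|a r]; [congruence|]. cbn. now rewrite cfst_cpair.
Qed.
Lemma tdrop_zero p : forall t, tsize t <= p -> tdrop p t = TZero.
Proof.
  induction p as [|p IH]; intros t Ht.
  - destruct t; [reflexivity|cbn in Ht; lia].
  - unfold tdrop. rewrite Nat.iter_succ_r. apply IH.
    destruct t as [|a r]; cbn in *; lia.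
Qed.

Section JumpSequence.
Variables A X : LO.
Hypothesis HA : is_LO A.
Hypothesis HX : is_LO X.
Notation le := (le_t A X).
Notation lt := (lt_t A X).
Notation nf := (nf_t A X).
Notation nfa := (nf_a A X).

Lemma ttl_nf t : nf t -> nf (ttl t).
Proof. destruct t; auto. intros H. apply H. Qed.
Lemma tdrop_nf p t : nf t -> nf (tdrop p t).
Proof. intros H. induction p as [|p IH]; auto. now apply (ttl_nf (tdrop p t)). Qed.

Lemma lt_nonzero t t' : lt t' t -> t <> TZero.
Proof. intros H ->. now apply lt_zero in H. Qed.
Lemma thd_nf t : nf t -> t <> TZero -> nfa (thd t).
Proof. destruct t; [congruence|]. intros H _. apply H. Qed.
Lemma le_thd t : nf t -> t <> TZero -> le (single (thd t)) t.
Proof.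
  destruct t as [|a r]; [congruence|]. intros H _. cbn [thd].
  apply le_single_sum. apply le_refl; auto. apply nf_single, H.
Qed.
Lemma lt_thd t t' : nf t -> nf t' -> t' <> TZero -> lt t' t ->
  le (single (thd t')) (single (thd t)).
Proof.
  intros H H' Hz Hlt. destruct t' as [|a r]; [congruence|].
  destruct t as [|b s]; [now apply lt_zero in Hlt|]. destruct Hlt as [Hle _].
  apply le_sum_iff in Hle; auto. destruct Hle as [[Hle _]|[-> _]]; auto.
  apply le_refl; auto. apply nf_single, H.
Qed.
Lemma lt_ttl t t' : nf t -> nf t' -> t' <> TZero -> thd t' = thd t -> lt t' t ->
  lt (ttl t') (ttl t).
Proof.
  intros H H' Hz He Hlt. destruct t' as [|a r]; [congruence|].
  destruct t as [|b s]; [now apply lt_zero in Hlt|]. cbn in He. subst b.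
  destruct Hlt as [Hle Hne].
  apply le_sum_iff in Hle; auto. cbn. destruct Hle as [[_ Hle]|[_ Hle]]; [congruence|].
  split; auto. congruence.
Qed.
Lemma thd_ttl t : nf t -> ttl t <> TZero -> le (single (thd (ttl t))) (single (thd t)).
Proof.
  destruct t as [|a [|b r]]; cbn [ttl]; try congruence. intros (_ & _ & H) _. exact H.
Qed.

Variable W : nat -> nat.
Variables e r : nat.
Variable s : nat -> term.
Hypothesis Hs : phi_descending A X s.
Notation cs := (fun k => code_term (s k)).
Notation st := (jump_state A W e r).
Hypothesis Hask : forall st,
  (ask A W e r (cpair 1 st) = 1 /\
     exists j, headc (csnd st) (cs (cfst st + j)) <> headc (csnd st) (cs (cfst st))) \/
  (ask A W e r (cpair 1 st) = 0 /\
     forall j, headc (csnd st) (cs (cfst st + j)) = headc (csnd st) (cs (cfst st))).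

Definition jtail (i m : nat) : term := tdrop (csnd (st i)) (s m).
Definition jinv (i : nat) : Prop := forall m, cfst (st i) <= m -> lt (jtail i (S m)) (jtail i m).
Definition jatom (i : nat) : atom := thd (jtail i (cfst (st i))).

Lemma jtail_nf i m : nf (jtail i m).
Proof. apply tdrop_nf, Hs. Qed.
Lemma jtail_nz i m : jinv i -> cfst (st i) <= m -> jtail i m <> TZero.
Proof. intros H Hm. eapply lt_nonzero, H, Hm. Qed.

Lemma st_S i :
  (cfst (st (S i)) = S (cfst (st i)) /\ csnd (st (S i)) = csnd (st i) /\
   exists j, headc (csnd (st i)) (cs (cfst (st i) + j)) <> headc (csnd (st i)) (cs (cfst (st i)))) \/
  (cfst (st (S i)) = cfst (st i) /\ csnd (st (S i)) = S (csnd (st i)) /\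
   forall j, headc (csnd (st i)) (cs (cfst (st i) + j)) = headc (csnd (st i)) (cs (cfst (st i)))).
Proof.
  change (st (S i)) with (jump_step A W e r (st i)). unfold jump_step.
  destruct (Hask (st i)) as [[-> H]|[-> H]]; cbn [cif]; rewrite cfst_cpair, csnd_cpair; auto.
Qed.

(** When the current summand never changes again, all later terms share it, and removing a common
    first summand leaves a descending sequence of tails. *)
Lemma jinv_S i : jinv i -> jinv (S i) /\ le (single (jatom (S i))) (single (jatom i)).
Proof.
  intros Hi. unfold jinv, jatom, jtail. destruct (st_S i) as [(-> & -> & _)|(-> & -> & Hj)].
  - split; [intros m Hm; apply Hi; lia|].
    apply lt_thd; auto using jtail_nf; try apply tdrop_nf, Hs.
    + apply jtail_nz; auto.
    + apply Hi. auto.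
  - assert (Hinv : forall m, cfst (st i) <= m ->
      lt (tdrop (S (csnd (st i))) (s (S m))) (tdrop (S (csnd (st i))) (s m))).
    { assert (Hh : forall m, cfst (st i) <= m -> thd (jtail i m) = jatom i).
      { intros m Hm. apply code_atom_inj. specialize (Hj (m - cfst (st i))).
        replace (cfst (st i) + (m - cfst (st i))) with m in Hj by lia.
        rewrite !headc_code in Hj; [exact Hj| |]; apply jtail_nz; auto. }
      intros m Hm. apply lt_ttl; try apply jtail_nf.
      - apply jtail_nz; auto.
      - transitivity (jatom i); [|symmetry]; apply Hh; lia.
      - apply Hi; auto. }
    split; auto.
    apply (@thd_ttl (jtail i (cfst (st i)))); [apply jtail_nf|].
    apply (lt_nonzero (Hinv _ (le_n _))).
Qed.

Lemma jinv_all i : jinv i.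
Proof.
  induction i as [|i IH]; [|now apply jinv_S].
  unfold jinv, jtail. change (st 0) with (cpair 0 0). rewrite csnd_cpair.
  intros m _. apply Hs.
Qed.

Lemma jump_out_code i : jump_out A W e r cs i = code_atom (jatom i).
Proof. apply headc_code. apply jtail_nz; auto using jinv_all. Qed.
Lemma jatom_nf i : nfa (jatom i).
Proof. apply thd_nf; [apply jtail_nf|]. apply jtail_nz; auto using jinv_all. Qed.
Lemma jatom_single_nf i : nf (single (jatom i)).
Proof. apply nf_single, jatom_nf. Qed.
Lemma jatom_mono i j : i <= j -> le (single (jatom j)) (single (jatom i)).
Proof.
  induction 1 as [|j _ IH]; [apply le_refl; auto using jatom_single_nf|].
  apply le_trans with (single (jatom j)); auto using jatom_single_nf.
  apply jinv_S, jinv_all.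
Qed.

(** After a positive answer the state moves one term on with the same summand. If the atom is still
    the same, the promised change has come one step nearer, hence induction on [j]. *)
Lemma jatom_change_of_query j : forall i,
  headc (csnd (st i)) (cs (cfst (st i) + j)) <> headc (csnd (st i)) (cs (cfst (st i))) ->
  exists i', i < i' /\ jatom i' <> jatom i.
Proof.
  induction j as [|j IH]; intros i Hj; [rewrite Nat.add_0_r in Hj; congruence|].
  destruct (st_S i) as [(E1 & E2 & _)|(_ & _ & H)]; [|now rewrite H in Hj].
  destruct (classic (jatom (S i) = jatom i)) as [E|Hne]; [|exists (S i); auto].
  destruct (IH (S i)) as (i' & Hi & Hne).
  - assert (E' := E). apply (f_equal code_atom) in E'.
    rewrite <- !jump_out_code in E'. unfold jump_out in E'.
    rewrite E', E1, E2. now rewrite <- plus_n_Sm in Hj.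
  - exists i'. split; [lia|congruence].
Qed.

(** If the atom stayed the same from [i] on, all answers would be negative, so the position in the
    sequence would stop while the number of dropped summands grew past the size of one fixed term;
    but the tails are never zero. *)
Lemma jatom_changes i : exists i', i < i' /\ jatom i' <> jatom i.
Proof.
  apply NNPP. intros Hn.
  assert (Heq : forall i', i <= i' -> jatom i' = jatom i).
  { intros i' Hi. apply NNPP. intros Hne. apply Hn. exists i'. split; auto.
    destruct (Nat.eq_dec i i'); [subst; congruence|lia]. }
  assert (Hst : forall k, cfst (st (i + k)) = cfst (st i) /\ csnd (st (i + k)) = csnd (st i) + k).
  { induction k as [|k [IH1 IH2]]; [rewrite !Nat.add_0_r; auto|].
    rewrite <- plus_n_Sm. destruct (st_S (i + k)) as [(_ & _ & j & Hj)|(-> & -> & _)]; [|lia].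
    exfalso. destruct (jatom_change_of_query _ _ Hj) as (i' & Hi & Hne).
    rewrite (Heq (i + k)) in Hne by lia. apply Hne, Heq. lia. }
  set (k := tsize (s (cfst (st i)))). destruct (Hst k) as [E1 E2].
  apply (@jtail_nz (i + k) (cfst (st i)) (jinv_all _)); [lia|].
  unfold jtail. rewrite E2. apply tdrop_zero. unfold k. lia.
Qed.

Lemma jump_sequence : exists (x : nat -> atom) (ix : nat -> nat),
  ix 0 = 0 /\
  (forall k, ix k <= ix (S k) /\
     jump_out A W e r cs (ix (S k)) <> jump_out A W e r cs (ix k) /\
     forall i, ix k <= i < ix (S k) -> jump_out A W e r cs i = jump_out A W e r cs (ix k)) /\
  (forall k, jump_out A W e r cs (ix k) = code_atom (x k) /\ nfa (x k) /\
     lt (single (x (S k))) (single (x k))) /\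
  le (single (x 0)) (s 0).
Proof.
  assert (Hnext : forall i, {j | (i < j /\ jatom j <> jatom i) /\
     forall m, m < j -> ~ (i < m /\ jatom m <> jatom i)}).
  { intros i. apply constructive_indefinite_description, least_nat, jatom_changes. }
  set (ix := fun k => Nat.iter k (fun i => proj1_sig (Hnext i)) 0).
  assert (Hix : forall k, (ix k < ix (S k) /\ jatom (ix (S k)) <> jatom (ix k)) /\
     forall m, m < ix (S k) -> ~ (ix k < m /\ jatom m <> jatom (ix k))).
  { intros k. exact (proj2_sig (Hnext (ix k))). }
  exists (fun k => jatom (ix k)), ix. split; [reflexivity|]. split; [|split].
  - intros k. destruct (Hix k) as [[H1 H2] H3]. split; [lia|]. split.
    + rewrite !jump_out_code. intros E. apply code_atom_inj in E. auto.
    + intros i Hi. rewrite !jump_out_code. f_equal. apply NNPP. intros Hne.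
      apply (H3 i); [lia|]. split; auto. destruct (Nat.eq_dec i (ix k)); [subst; congruence|lia].
  - intros k. destruct (Hix k) as [[H1 H2] _]. split; [apply jump_out_code|].
    split; [apply jatom_nf|]. split; [apply jatom_mono; lia|].
    intros E. apply H2. injection E. auto.
  - change (ix 0) with 0.
    assert (E : forall m, jtail 0 m = s m).
    { intros m. unfold jtail. change (st 0) with (cpair 0 0). now rewrite csnd_cpair. }
    unfold jatom. change (st 0) with (cpair 0 0). rewrite cfst_cpair, E.
    apply le_thd; [apply Hs|]. rewrite <- E. apply jtail_nz; [apply jinv_all|].
    change (st 0) with (cpair 0 0). now rewrite cfst_cpair.
Qed.

End JumpSequence.

(** * Recursion along the well-ordering *)

Lemma pchar_cases (P : nat -> Prop) n :
  (pchar P n = 1 /\ P n) \/ (pchar P n = 0 /\ ~ P n).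
Proof. unfold pchar. destruct (excluded_middle_informative (P n)); tauto. Qed.

Lemma column_ok_pchar (P : nat -> Prop) O c :
  (forall n, P (cpair c n) <-> jumpP O n) -> column_ok (pchar P) O c.
Proof.
  intros H n. specialize (H n). destruct (pchar_cases P (cpair c n)) as [[-> Hn]|[-> Hn]]; tauto.
Qed.

Lemma iter_push d n p :
  Nat.iter n (fun r => S (cpair d r)) (code_list p) = code_list (repeat d n ++ p).
Proof.
  induction n as [|n IH]; [reflexivity|].
  change (S (cpair d (Nat.iter n (fun r => S (cpair d r)) (code_list p))) =
    code_list (repeat d (S n) ++ p)). now rewrite IH.
Qed.

Lemma Forall_repeat (T : Type) (P : T -> Prop) a n : P a -> Forall P (repeat a n).
Proof. intros H. induction n; cbn; auto. Qed.

Section Main.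
Variable Z : nat -> nat.
Variables A X : LO.
Hypothesis HA : is_LO A.
Hypothesis HX : is_LO X.
Hypothesis Hwf : well_founded (lto A).
Variable o0 : nat.
Variable g : nat -> term.
Variables pa pg : prog.
Hypothesis ev_pa : forall W x y, eval (join Z W) pa [x; y] (pchar2 (leo A) x y).
Hypothesis ev_pg : forall W n, eval (join Z W) pg [n] (code_term (g n)).
Hypothesis Hg : phi_descending A X g.
Variable e : nat.
Hypothesis He : is_code e (p_test o0 pa pg).
Variable Y : nat -> Prop.
Hypothesis HY : jump_hierarchy Z (omega_exp A) Y.
Notation le := (le_t A X).
Notation lt := (lt_t A X).
Notation nf := (nf_t A X).
Notation nfa := (nf_a A X).

Definition column (p : list nat) : nat := code_list (cnf A p).
(** The column at [p] is the jump of this oracle, so it decides questions about computations that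
    use only earlier columns. *)
Definition oracle_at (p : list nat) : nat -> nat :=
  join Z (pchar (below (omega_exp A) Y (column p))).

Definition computed_at (p : list nat) (s : nat -> term) : Prop :=
  Forall (fld A) p /\ phi_descending A X s /\
  forall k, eval (oracle_at p) (p_seq o0 pa pg) [e; code_list p; k] (code_term (s k)).

Definition answers (W : nat -> nat) (p : list nat) : Prop :=
  column_ok W (oracle_at p) (ccnf A (code_list p)).

Lemma computed_at_nil : computed_at [] g.
Proof.
  split; [constructor|]. split; [exact Hg|]. intros k.
  apply (@ev_seq_nil Z o0 (fun k => code_term (g k)) pa pg ev_pg).
Qed.

Lemma answers_top p : Forall (fld A) p -> answers (pchar Y) p.
Proof.
  intros Hp. apply column_ok_pchar. intros n. rewrite ccnf_code.
  apply HY. now apply cnf_fld.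
Qed.

Lemma answers_below c q p : fld A c -> Forall (fld A) p -> Forall (fun x => lto A x c) q ->
  answers (pchar (below (omega_exp A) Y (column (c :: p)))) (q ++ p).
Proof.
  intros Hc Hp Hq. apply column_ok_pchar. intros n. rewrite ccnf_code.
  assert (Hq' : Forall (fld A) q).
  { eapply Forall_impl; [|exact Hq]. intros x [Hx _]. now apply (LO_fld HA) in Hx. }
  assert (Hlt := cnf_lt HA Hc Hp Hq).
  transitivity (Y (cpair (column (q ++ p)) n));
    [|apply HY, cnf_fld, Forall_app; auto]. split.
  - intros (c' & n' & E & _ & H). apply cpair_inj in E. destruct E. subst c' n'. exact H.
  - intros H. do 2 eexists. split; [reflexivity|]. split; auto.
Qed.

(** A bound phi_c(t) on the first term becomes the bound [t]. The intermediate [w] is the collapse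
    of the omitted first atom; for [t] = x + 1 it gives [w <= x], so the new sequence starts
    strictly below x. *)
Definition bounded_below (c : nat) (s s' : nat -> term) : Prop :=
  forall t, nf (single (APhi c t)) -> lt (s 0) (single (APhi c t)) ->
  exists w, nf w /\ lt (s' 0) w /\ lt w t.

(** All [p] and [s] are allowed because [tower_descent] applies the property again to its own
    result, one power later. *)
Definition reducible (c : nat) : Prop :=
  forall p s, computed_at p s -> exists s', computed_at (c :: p) s' /\ bounded_below c s s'.

Lemma clow_high c d : leo A c d -> clow A (S c) d = 0.
Proof.
  intros H. unfold clow. cbn [cif pred].
  destruct (pchar2_cases (leo A) c d) as [[-> _]|[_ Hn]]; [reflexivity|tauto].
Qed.

Lemma coll_descending c s x : fld A c -> phi_descending A X s ->
  (forall k, nfa (x k) /\ high A (S c) (x k) /\ lt (single (x (S k))) (single (x k))) ->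
  le (single (x 0)) (s 0) ->
  phi_descending A X (fun k => coll c (x (S k))) /\
  bounded_below c s (fun k => coll c (x (S k))).
Proof.
  intros Hc Hs Hx H0.
  assert (Hlt : forall k, lt (coll c (x (S k))) (coll c (x k))).
  { intros k. destruct (Hx k) as (H1 & H2 & H3), (Hx (S k)) as (H4 & H5 & _).
    apply coll_lt; auto. }
  split.
  - intros n. split; auto. apply coll_nf, Hx.
  - intros t Ht Hst. exists (coll c (x 0)). split; [apply coll_nf, Hx|]. split; auto.
    destruct (Hx 0) as (H1 & H2 & _).
    assert (E : coll c (APhi c t) = t) by (cbn; now rewrite Nat.eqb_refl).
    rewrite <- E. apply coll_lt; auto.
    + apply Ht.
    + cbn. apply clow_high. apply LO_refl; auto.
    + apply (le_lt_trans HA HX) with (s 0); auto; [now apply nf_single|apply Hs].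
Qed.

Lemma jump_atoms W p s : computed_at p s -> answers W p ->
  exists x : nat -> atom,
    (forall k, nfa (x k) /\ lt (single (x (S k))) (single (x k))) /\
    le (single (x 0)) (s 0) /\
    forall k, eval (join Z W) (p_jump pa) [e; code_list p; k] (code_atom (x k)).
Proof.
  intros (Hp & Hs & Hev) HW.
  destruct (@jump_sequence A X HA HX W e (code_list p) s Hs
    (fun st => ask_jump A st _ He HW Hev)) as (x & ix & H0 & H1 & H2 & H3).
  exists x. split; [intros k; split; apply H2|]. split; [exact H3|].
  intros k. destruct (H2 k) as [<- _]. apply (ev_jump A ev_pa); auto.
  intros i v. apply (@ask_val Z A o0 pa pg W _ e _ i v (fun k => code_term (s k)) He HW Hev).
Qed.

Hypothesis Hmin : forall d, fld A d -> leo A o0 d.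

(** Every atom is high for the least index, so the heads found with one jump can be collapsed at
    once. *)
Lemma reducible_min : fld A o0 -> reducible o0.
Proof.
  intros Ho p s Hgood. assert (Hgood' := Hgood). destruct Hgood' as (Hp & Hs & _).
  destruct (@jump_atoms _ p s Hgood (@answers_below o0 [] p Ho Hp (Forall_nil _)))
    as (x & Hx & H0 & Hev).
  destruct (@coll_descending o0 s x) as [H1 H2]; auto.
  { intros k. destruct (Hx k) as [Hn Hl]. repeat split; auto; try apply Hl.
    destruct (x k) as [y|d u]; [exact I|]. cbn. apply clow_high, Hmin, Hn. }
  exists (fun k => coll o0 (x (S k))). split; [|exact H2].
  split; [auto|]. split; [exact H1|]. intros k. rewrite <- code_coll.
  apply ev_seq_jump. apply Hev.
Qed.

(** Each use of [reducible d] peels one phi_d off the tower and costs one more omega^d. *)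
Lemma tower_descent d : fld A o0 -> fld A d -> reducible d ->
  forall t, nf t -> forall m p s, computed_at p s ->
  lt (s 0) (tower d (S m) (succ_head o0 t)) ->
  exists s', computed_at (repeat d (S m) ++ p) s' /\
    exists w, nf w /\ lt (s' 0) w /\ lt w (succ_head o0 t).
Proof.
  intros Ho Hd Hred t Ht m. induction m as [|m IH]; intros p s Hp Hlt.
  - destruct (Hred p s Hp) as (s' & Hs' & Hb). exists s'. split; auto.
    apply (Hb (succ_head o0 t)); auto. apply (tower_nf X HA o0 Hmin Ho d 1 t Hd Ht).
  - assert (N1 := tower_nf X HA o0 Hmin Ho d (S m) t Hd Ht).
    destruct (Hred p s Hp) as (s1 & Hs1 & Hb).
    destruct (Hb (tower d (S m) (succ_head o0 t))) as (w & Nw & H1 & H2); auto.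
    { apply (tower_nf X HA o0 Hmin Ho d (S (S m)) t Hd Ht). }
    destruct (IH (d :: p) s1 Hs1) as (s' & Hs' & Hw).
    { apply (lt_trans HA HX) with w; auto. apply Hs1. }
    exists s'. split; auto.
    change (repeat d (S (S m)) ++ p) with ((d :: repeat d (S m)) ++ p).
    rewrite repeat_cons, <- app_assoc. exact Hs'.
Qed.

Definition low_index (h d : nat) : Prop := fld A d /\ clow A h d <> 0.

Lemma path_step h : (forall d, low_index h d -> reducible d) -> low_index h o0 ->
  forall p s, computed_at p s -> exists q s' a r,
    strip A h (s 0) = TSum a r /\ Forall (low_index h) q /\
    code_list (q ++ p) = extend A o0 h (code_term (s 0)) (code_list p) /\
    computed_at (q ++ p) s' /\ lt (s' 0) (single a).
Proof.
  intros Hred [Ho Hlo] p s Hp. assert (Hs : phi_descending A X s) by apply Hp.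
  assert (N0 : nf (s 0)) by apply Hs.
  assert (Nx := strip_nf A X h (s 0) N0).
  destruct (strip_max_ge X HA h (s 0) o0 N0 Ho) as [Hd _].
  assert (Hdl := strip_max_low A X h (s 0) o0 N0 Hlo).
  set (d := strip_max A h (s 0) o0) in *.
  set (n := code_term (s 0)).
  destruct (@tower_descent d Ho Hd (Hred d (conj Hd Hdl)) (strip A h (s 0)) Nx n p s Hp)
    as (s' & Hs' & w & Nw & H1 & H2).
  { apply (lt_tower HA HX o0 Hmin Ho h d Hd Hdl (s 0) o0); auto. apply LO_refl; auto. }
  assert (Ha := lt_succ_head HA HX o0 Hmin Ho _ Nw Nx H2).
  destruct (strip A h (s 0)) as [|a r] eqn:E.
  - subst w. now apply lt_zero in H1.
  - exists (repeat d (S n)), s', a, r. split; auto. split; [|split; [|split; [exact Hs'|]]].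
    + apply Forall_repeat. split; auto.
    + unfold extend, n. rewrite strip_run_code, csnd_cpair. symmetry. apply iter_push.
    + apply (lt_le_trans HA HX) with w; auto; [apply Hs'|apply nf_single, Nx].
Qed.

Lemma path_atoms h W p s : (forall d, low_index h d -> reducible d) -> low_index h o0 ->
  computed_at p s ->
  (forall q, Forall (low_index h) q -> answers W (q ++ p)) ->
  exists x : nat -> atom,
    (forall k, nfa (x k) /\ high A h (x k) /\ lt (single (x (S k))) (single (x k))) /\
    le (single (x 0)) (s 0) /\
    forall k, eval (join Z W) (p_lim o0 pa) [e; code_list p; h; k] (code_atom (x k)).
Proof.
  intros Hred Ho Hp HW.
  (* The sequences along the path are obtained by dependent choice, but the sums are fixed by the
     equation with [extend], so the program can retrace them. *)
  set (T := {y : list nat * (nat -> term) | computed_at (fst y ++ p) (snd y) /\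
    Forall (low_index h) (fst y)}).
  assert (Hstep : forall y : T, {y' : T | exists a r,
    strip A h (snd (proj1_sig y) 0) = TSum a r /\
    code_list (fst (proj1_sig y') ++ p) =
      extend A o0 h (code_term (snd (proj1_sig y) 0)) (code_list (fst (proj1_sig y) ++ p)) /\
    lt (snd (proj1_sig y') 0) (single a)}).
  { intros [[q s1] [Hc Hq]]. apply constructive_indefinite_description. cbn in *.
    destruct (path_step Hred Ho Hc) as (q' & s' & a & r & E1 & Hq' & E2 & Hc' & Hlt).
    rewrite app_assoc in Hc', E2.
    exists (exist (fun y : list nat * (nat -> term) => computed_at (fst y ++ p) (snd y) /\
       Forall (low_index h) (fst y)) (q' ++ q, s') (conj Hc' (proj2 (Forall_app _ _ _) (conj Hq' Hq)))).
    exists a, r. cbn. auto. }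
  assert (H0 : computed_at (fst ([] : list nat, s) ++ p) (snd ([] : list nat, s)) /\
    Forall (low_index h) (fst ([] : list nat, s))) by (cbn; auto).
  set (y := fun n => Nat.iter n (fun y => proj1_sig (Hstep y)) (exist _ ([], s) H0 : T)).
  set (r := fun n => code_list (fst (proj1_sig (y n)) ++ p)).
  set (t := fun n => snd (proj1_sig (y n)) 0).
  assert (Hy : forall n, exists a u, strip A h (t n) = TSum a u /\
    r (S n) = extend A o0 h (code_term (t n)) (r n) /\ lt (t (S n)) (single a)).
  { intros n. exact (proj2_sig (Hstep (y n))). }
  assert (Nt : forall n, nf (t n)).
  { intros n. unfold t. destruct (proj2_sig (y n)) as [(_ & H & _) _]. apply H. }
  set (x := fun n => thd (strip A h (t n))).
  assert (Hx : forall n, nfa (x n) /\ high A h (x n) /\ le (single (x n)) (t n) /\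
     lt (t (S n)) (single (x n)) /\ code_atom (x n) = cfst (pred (code_term (strip A h (t n))))).
  { intros n. unfold x. destruct (Hy n) as (a & u & E & _ & Hlt).
    destruct (strip_high HA HX h (t n) (Nt n) E) as [H1 H2].
    assert (Nn := strip_nf A X h (t n) (Nt n)). rewrite E in *. cbn [thd].
    split; [apply Nn|]. repeat split; auto; try apply Hlt.
    cbn. now rewrite cfst_cpair. }
  exists x. split; [|split].
  (* [x (S k) <= t (S k) < x k]: an atom is at most the term it was stripped from, and that term
     starts below the previous atom. *)
  - intros k. destruct (Hx k) as (H1 & H2 & H3 & H4 & _), (Hx (S k)) as (H5 & _ & H6 & _).
    split; auto. split; auto. apply (le_lt_trans HA HX) with (t (S k)); auto; now apply nf_single.
  - apply (Hx 0).
  - intros k. destruct (Hx k) as (_ & _ & _ & _ & ->).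
    replace (code_term (strip A h (t k))) with (cfst (strip_run A o0 h (code_term (t k))))
      by (rewrite strip_run_code; apply cfst_cpair).
    apply (ev_lim ev_pa W e k r (fun n => code_term (t n))).
    + intros i v. destruct (proj2_sig (y i)) as [(Hc & _ & Hev) Hq].
      apply (@ask_val Z A o0 pa pg W _ e _ 0 v
        (fun k => code_term (snd (proj1_sig (y i)) k)) He (HW _ Hq) Hev).
    + intros i. destruct (Hy i) as (a & u & _ & E & _). exact E.
Qed.

(** Induction on the index: the path for [c] adds only powers with smaller exponents, whose columns
    the oracle at [c :: p] contains. *)
Lemma all_reducible c : fld A c -> reducible c.
Proof.
  induction (Hwf c) as [c _ IH]. intros Hc.
  assert (Ho : fld A o0) by (destruct (LO_fld HA (Hmin _ Hc)); auto).
  destruct (Nat.eq_dec c o0) as [->|Hne]; [now apply reducible_min|].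
  intros p s Hgood. assert (Hgood' := Hgood). destruct Hgood' as (Hp & Hs & _).
  assert (Hlow : forall d, low_index (S c) d -> lto A d c).
  { intros d [Hd Hl]. now apply clow_S_low. }
  destruct (@path_atoms (S c) (pchar (below (omega_exp A) Y (column (c :: p)))) p s)
    as (x & Hx & H0 & Hev); auto.
  { intros d Hd. apply IH; auto. apply Hd. }
  { split; auto. apply clow_S_lt; auto. split; auto. }
  { intros q Hq. apply answers_below; auto.
    eapply Forall_impl; [|exact Hq]. exact Hlow. }
  destruct (@coll_descending c s x) as [H1 H2]; auto.
  exists (fun k => coll c (x (S k))). split; [|exact H2].
  split; [auto|]. split; [exact H1|]. intros k. rewrite <- code_coll.
  apply ev_seq_lim; auto.
Qed.

End Main.

(** * From the hierarchy to a descending sequence *)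

Definition ceven (n : nat) : nat := if Nat.even n then 1 else 0.
Definition p_even : prog := PRec (p_cst 1) (PComp p_not [PProj 1]).
Lemma ev_even O n : eval O p_even [n] (ceven n).
Proof.
  apply (@ev_prec O _ _ ceven); [apply ev_cst|]. intros i _. evs.
  unfold ceven. rewrite Nat.even_succ, <- Nat.negb_even. now destruct (Nat.even i).
Qed.
#[export] Hint Resolve ev_even : evdb.

Lemma div2_S n : Nat.div2 (S n) = Nat.div2 n + cnot (ceven n).
Proof.
  unfold ceven. destruct (Nat.Even_or_Odd n) as [[k ->]|[k ->]].
  - rewrite Nat.even_even, Nat.div2_succ_double, Nat.div2_double. cbn. lia.
  - rewrite Nat.add_1_r, Nat.even_succ, Nat.odd_even, Nat.div2_succ_double.
    replace (S (S (2 * k))) with (2 * S k) by lia. rewrite Nat.div2_double. cbn. lia.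
Qed.
Definition p_half : prog :=
  PRec PZero (PComp p_add [PProj 1; PComp p_not [PComp p_even [PProj 0]]]).
Lemma ev_half O n : eval O p_half [n] (Nat.div2 n).
Proof.
  apply (@ev_prec O _ _ Nat.div2); [constructor|]. intros i _. evs. now rewrite div2_S.
Qed.
#[export] Hint Resolve ev_half : evdb.

(** The programs run with [join Z (pchar Y)], while the conclusion allows only [pchar Y]. Any column
    decides the graph of [Z], being the jump of an oracle containing [Z], and a search gives the
    values. *)
Lemma base_oracle_computable Z B Y c : jump_hierarchy Z B Y -> fld B c ->
  exists r, forall x, eval (pchar Y) r [x] (Z x).
Proof.
  intros HY Hc.
  set (M := PComp p_not [PComp p_eq
    [PComp p_left [PComp p_cfst [PProj 2]]; PComp p_csnd [PProj 2]]]).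
  destruct (has_code M) as [e He].
  assert (HM : forall W j m, eval (join Z W) M [j; cpair e 0; m]
     (cnot (ceq (Z (cfst m)) (csnd m)))) by (intros; evs; reflexivity).
  assert (HQ : forall m, Y (cpair c (query e 0 m)) <-> Z (cfst m) = csnd m).
  { intros m. rewrite (proj2 HY c _ Hc).
    rewrite (@jumpP_query _ M e 0 m (fun _ => cnot (ceq (Z (cfst m)) (csnd m))) He) by (intros; apply HM).
    rewrite <- (ceq_1 (Z (cfst m)) (csnd m)). unfold ceq. destruct (Z (cfst m) =? csnd m); cbn; split;
      [intros; reflexivity|intros; exists 0; reflexivity|intros [? ?]; discriminate|discriminate]. }
  clear He HM.
  exists (PMu (PComp p_not [PComp POrc [PComp p_cpair [p_cst c;
     PComp p_query [p_cst e; p_cst 0; PComp p_cpair [PProj 1; PProj 0]]]]])).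
  intros x.
  assert (Hor : forall k, eval (pchar Y) POrc [k] (pchar Y k)) by (intros k; exact (ev_orc (pchar Y) [k])).
  assert (Hv : forall v, pchar Y (cpair c (query e 0 (cpair x v))) = ceq (Z x) v).
  { intros v. specialize (HQ (cpair x v)). rewrite cfst_cpair, csnd_cpair in HQ.
    destruct (pchar_cases Y (cpair c (query e 0 (cpair x v)))) as [[-> H]|[-> H]]; symmetry.
    - now apply ceq_1, HQ.
    - apply ceq_0. tauto. }
  constructor.
  - evs. rewrite Hv. now rewrite (proj2 (ceq_1 (Z x) (Z x))).
  - intros v Hlt. exists 0. evs. rewrite Hv. rewrite (proj2 (ceq_0 (Z x) v)); auto. lia.
Qed.

Lemma join_computable Z O r : (forall x, eval O r [x] (Z x)) ->
  exists r', forall x, eval O r' [x] (join Z O x).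
Proof.
  intros Hr.
  exists (PComp p_if [PComp p_even [PProj 0]; PComp r [PComp p_half [PProj 0]];
    PComp POrc [PComp p_half [PProj 0]]]).
  intros x.
  assert (Hor : forall k, eval O POrc [k] (O k)) by (intros k; exact (ev_orc O [k])).
  evs. unfold join, ceven. destruct (Nat.even x); reflexivity.
Qed.

Lemma descending_of_consts A X O (x : nat -> atom) p :
  (forall k, nf_a A X (x k) /\ lt_t A X (single (x (S k))) (single (x k))) ->
  (forall k, exists y, x k = AConst y) ->
  (forall k, eval O p [k] (code_atom (x k))) ->
  exists f, descending X f /\ computable1 O f.
Proof.
  intros Hx Hc Hp. exists (fun k => csnd (code_atom (x k))). split.
  - intros k. destruct (Hx k) as [H1 [H2 H3]]. destruct (Hc k) as [y E], (Hc (S k)) as [y' E'].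
    rewrite E, E' in *. cbn [code_atom]. rewrite !csnd_cpair. split; [exact H1|].
    apply (le_atom_eq A X) in H2; [|exact I]. split; [exact H2|]. intros ->. auto.
  - exists (PComp p_csnd [PComp p [PProj 0]]). intros n. evs. reflexivity.
Qed.

Theorem theorem3p6 (Z : nat -> nat) (alpha X : LO) :
  is_WO alpha -> computable_LO Z alpha ->
  is_LO X -> computable_LO Z X ->
  (exists g : nat -> term,
      phi_descending alpha X g /\ computable1 Z (fun n => code_term (g n))) ->
  (exists Y, jump_hierarchy Z (omega_exp alpha) Y) /\
  (forall Y, jump_hierarchy Z (omega_exp alpha) Y ->
     exists f, descending X f /\ computable1 (pchar Y) f).
Proof.
  intros [HA Hd] [_ [qa Hqa]] HX _ [g [Hg [qg Hqg]]].
  assert (Hwf := wf_of_no_descending HA Hd).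
  split; [apply jump_hierarchy_exists; now apply omega_exp_wf|].
  intros Y HY.
  set (pa := p_subst p_left qa). set (pg := p_subst p_left qg).
  assert (ev_pa : forall W x y, eval (join Z W) pa [x; y] (pchar2 (leo alpha) x y)).
  { intros. eapply ev_subst; [apply ev_left|apply Hqa]. }
  assert (ev_pg : forall W n, eval (join Z W) pg [n] (code_term (g n))).
  { intros. eapply ev_subst; [apply ev_left|apply Hqg]. }
  destruct (@base_oracle_computable Z _ Y (code_list []) HY) as [r0 Hr0].
  { apply (cnf_fld alpha (p := [])). constructor. }
  destruct (@join_computable Z (pchar Y) r0 Hr0) as [r Hr].
  assert (Hred : forall x p, (forall k, eval (join Z (pchar Y)) p [k] (code_atom (x k))) ->
    forall k, eval (pchar Y) (p_subst r p) [k] (code_atom (x k))).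
  { intros x p Hp k. eapply ev_subst; [exact Hr|apply Hp]. }
  assert (Hmin : (forall d, ~ fld alpha d) \/
    exists o0, fld alpha o0 /\ forall d, fld alpha d -> leo alpha o0 d).
  { destruct (classic (exists d, fld alpha d)) as [[d Hfd]|H]; [right|left; firstorder].
    revert Hfd. induction (Hwf d) as [d _ IH]. intros Hfd.
    destruct (classic (exists c, lto alpha c d)) as [[c Hc]|Hn].
    - apply (IH c Hc). destruct Hc as [Hc _]. now apply (LO_fld HA) in Hc.
    - exists d. split; auto. intros c Hfc. destruct (LO_total HA Hfc Hfd) as [H|H]; auto.
      destruct (Nat.eq_dec c d) as [->|Hne]; auto. exfalso. apply Hn. exists c. split; auto. }
  destruct Hmin as [Hempty|[o0 [Ho Hmin]]].
  (* With no indices every atom is a constant, omega^alpha is 1, and the single jump in the column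
     [[]] suffices. The least index is replaced by the dummy [0]. *)
  - destruct (has_code (p_test 0 pa pg)) as [e He].
    destruct (@jump_atoms Z alpha X HA HX 0 pa pg ev_pa e He Y (pchar Y) [] g)
      as (x & Hx & _ & Hev).
    { now apply computed_at_nil. }
    { apply answers_top; auto. }
    apply (@descending_of_consts alpha X _ x
      (p_subst r (PComp (p_jump pa) [p_cst e; p_cst 0; PProj 0])) Hx).
    + intros k. destruct (Hx k) as [H _]. destruct (x k) as [y|d u]; [eauto|].
      exfalso. apply (Hempty d), H.
    + apply Hred. intros k.
      assert (H : eval (join Z (pchar Y)) (p_jump pa) [e; 0; k] (code_atom (x k))) by apply Hev.
      clear He. evs. reflexivity.
  - destruct (has_code (p_test o0 pa pg)) as [e He].
    (* The bound [0] makes every index low, so the high atoms are exactly the constants. *)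
    destruct (@path_atoms Z alpha X HA HX o0 pa pg ev_pa e He Y Hmin 0 (pchar Y) [] g)
      as (x & Hx & _ & Hev).
    { intros d [Hfd _]. now apply (all_reducible HA HX Hwf ev_pa He HY Hmin). }
    { split; [exact Ho|discriminate]. }
    { now apply computed_at_nil. }
    { intros q Hq. apply answers_top; auto. rewrite app_nil_r.
      eapply Forall_impl; [|exact Hq]. intros d [Hfd _]. exact Hfd. }
    apply (@descending_of_consts alpha X _ x
      (p_subst r (PComp (p_lim o0 pa) [p_cst e; p_cst 0; p_cst 0; PProj 0]))).
    + intros k. split; apply Hx.
    + intros k. destruct (Hx k) as (_ & H & _). destruct (x k) as [y|d u]; [eauto|]. discriminate H.
    + apply Hred. intros k.
      assert (H : eval (join Z (pchar Y)) (p_lim o0 pa) [e; 0; 0; k] (code_atom (x k))) by apply Hev.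
      clear He. evs. reflexivity.
Qed.
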